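(* Consider the $(3,5)$-semi-homogeneous family $$\dot{x}=-y^3+a_{30}x^3+a_{21}x^2y+a_{12}xy^2,\qquad \dot{y}=x^5+b_{41}x^4y+b_{32}x^3y^2+b_{23}x^2y^3+b_{14}xy^4+b_{05}y^5,$$ with real coefficients, restricted to the monodromic parameter space $\Lambda=\{a_{30}=0,\ a_{12}^2+4a_{21}<0\}$. If the origin is a center, then $L_1=0$, where \begin{align*} L_1={}& a_{12}^5+5a_{12}^3a_{21}+5a_{12}a_{21}^2-2a_{21}^5b_{05}+a_{12}a_{21}^4b_{14}-a_{12}^2a_{21}^3b_{23}\\ &-2a_{21}^4b_{23}+a_{12}^3a_{21}^2b_{32}+3a_{12}a_{21}^3b_{32}-a_{12}^4a_{21}b_{41}-4a_{12}^2a_{21}^2b_{41}-2a_{21}^3b_{41}. \end{align*}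
   Context: A singularity is monodromic if nearby orbits rotate around it, so that a Poincaré return map is defined on a small transversal section with endpoint at the singularity; $\Lambda$ is the set of parameters of the family for which the origin is monodromic. A monodromic singularity is a center if all nearby orbits are periodic orbits surrounding it. *)

(* Defs.v *)
From Stdlib Require Import Reals.
From Coquelicot Require Import Coquelicot.
Open Scope R_scope.

(** Stdlib reals with Coquelicot's derivatives and continuity. *)

Definition is_solution (P Q : R -> R -> R) (x y : R -> R) : Prop :=
  forall t : R,
    is_derive x t (P (x t) (y t)) /\ is_derive y t (Q (x t) (y t)).

Definition periodic_with (T : R) (x y : R -> R) : Prop :=
  0 < T /\ forall t : R, x (t + T) = x t /\ y (t + T) = y t.

Definition orbit (x y : R -> R) : R * R -> Prop :=
  fun p => exists t : R, p = (x t, y t).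

(** A path on [[0, 1]] is represented by a continuous extension of it to [R]. *)
Definition path_joined_in (S : R * R -> Prop) (p q : R * R) : Prop :=
  exists gamma : R -> R * R,
    (forall s : R, continuous gamma s) /\
    gamma 0 = p /\ gamma 1 = q /\
    (forall s : R, 0 <= s <= 1 -> S (gamma s)).

(** [p] lies in a bounded component of the complement of [C]. A single point
    surrounds nothing, so an equilibrium, although it is [T]-periodic for every
    [T], never counts as an orbit surrounding [p]. *)
Definition surrounds (C : R * R -> Prop) (p : R * R) : Prop :=
  ~ C p /\
  exists M : R, forall q : R * R,
    path_joined_in (fun z => ~ C z) p q ->
    Rabs (fst q) <= M /\ Rabs (snd q) <= M.

(** Monodromy is not a separate clause: here a center is only considered for
    parameters in [Lambda], where the origin is monodromic. *)
Definition center_at_origin (P Q : R -> R -> R) : Prop :=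
  P 0 0 = 0 /\ Q 0 0 = 0 /\
  exists r : R, 0 < r /\
    forall x0 y0 : R, 0 < x0 ^ 2 + y0 ^ 2 < r ^ 2 ->
      exists x y : R -> R,
        is_solution P Q x y /\ x 0 = x0 /\ y 0 = y0 /\
        (exists T : R, periodic_with T x y) /\
        surrounds (orbit x y) (0, 0).

Definition P35 (a30 a21 a12 : R) (x y : R) : R :=
  - y ^ 3 + a30 * x ^ 3 + a21 * x ^ 2 * y + a12 * x * y ^ 2.

Definition Q35 (b41 b32 b23 b14 b05 : R) (x y : R) : R :=
  x ^ 5 + b41 * x ^ 4 * y + b32 * x ^ 3 * y ^ 2 + b23 * x ^ 2 * y ^ 3
  + b14 * x * y ^ 4 + b05 * y ^ 5.

Definition Lambda (a30 a21 a12 : R) : Prop :=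
  a30 = 0 /\ a12 ^ 2 + 4 * a21 < 0.

Definition L1 (a21 a12 b41 b32 b23 b14 b05 : R) : R :=
  a12 ^ 5 + 5 * a12 ^ 3 * a21 + 5 * a12 * a21 ^ 2 - 2 * a21 ^ 5 * b05
  + a12 * a21 ^ 4 * b14 - a12 ^ 2 * a21 ^ 3 * b23
  - 2 * a21 ^ 4 * b23 + a12 ^ 3 * a21 ^ 2 * b32 + 3 * a12 * a21 ^ 3 * b32
  - a12 ^ 4 * a21 * b41 - 4 * a12 ^ 2 * a21 ^ 2 * b41 - 2 * a21 ^ 3 * b41.

(* Main.v *)
(** Write [a21 = - w] and [a = a12], so that [x' = - y q(x, y)] with [q = y^2 - a x y + w x^2]
    positive definite.  On a periodic orbit near the origin choose the crossing [(c, 0)] with the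
    axis [y = 0] that is closest to the origin (by central symmetry [c > 0]).  The following arc
    in [y > 0] is a graph over an interval containing [[-c, c]], so that
    [W(z) = y(c z)^2 / c^4] solves a scalar equation on [[-1, 1]] with [W(1) = 0 <= W(-1)].
    The part of the slope [- Q / q] that is odd in [x] is reversible, hence contributes to the
    difference [W(z) - W(- z)] only through a Gronwall factor tending to 1; the even part is
    [y (al x^2 + be y^2 + ...)], where the dots stand for a remainder concentrated in
    [|x| <= |y|], whose integral across the arc is a multiple of [ga + w de].  The first nonzero
    number among [al], [be], [ga + w de] therefore decides, for small [c], the sign of
    [W(1) - W(-1) <= 0], and none of them can be positive.  Reversing time together with [x]
    changes the sign of all three, so they vanish at a center; and [L1] is a multiple of the
    last one modulo the first two. *)

Require Import Defs.
From Stdlib Require Import Reals Lra.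
From Coquelicot Require Import Coquelicot.
Open Scope R_scope.

(** * Real analysis *)

(** Why [c^4]: away from the axis [x = 0] the arc obeys [x' ~ - w x^2 y] and [y' ~ x^5], hence
    [y^2 ~ (c^4 - x^4) / (2 w)], and [y] has size [c^2]. After scaling [x] by [c] and [y] by [c^2],
    the small parameter is [eps = c] itself, and [-Q / q] is evaluated at [(z, eps * sqrt W)]. The
    even part then has three different sizes: [eps] from [al], [eps^3] from [be], and [eps^4] from
    the remainder. The last one is the difficulty: the remainder is [O(eps^5)] for [x] of order 1,
    but of order [eps^3] on a window of width [eps] around [0], so that no expansion in [eps] is
    uniform there. On this window [W] is frozen at [W 0] and the integral is computed on the scale
    [z = x / y]. The arc is compared with its own mirror image, not with a second arc. The crossing
    opposite to [c] is only known to lie at or beyond [- c], so the comparison yields an inequality;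
    this is why signs are excluded one at a time and time reversal supplies the other sign. *)

Lemma is_derive_eq (f : R -> R) (x l l' : R) :
  is_derive f x l -> l = l' -> is_derive f x l'.
Proof. now intros H <-. Qed.

Lemma is_derive_continuity_pt (f : R -> R) (x l : R) :
  is_derive f x l -> continuity_pt f x.
Proof.
  intros H. apply derivable_continuous_pt. exists l. now apply is_derive_Reals.
Qed.

(** The derivative is asked only in the open interval: at the ends of an arc, where [y] may vanish,
    a half turn provides continuity alone. *)
Lemma mvt_open (f df : R -> R) (a b : R) :
  a < b ->
  (forall x, a < x < b -> is_derive f x (df x)) ->
  (forall x, a <= x <= b -> continuity_pt f x) ->
  exists c, a < c < b /\ f b - f a = df c * (b - a).
Proof.
  intros hab hd hc.
  assert (pr1 : forall c, a < c < b -> derivable_pt f c).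
  { intros c h. exists (df c). now apply is_derive_Reals, hd. }
  assert (pr2 : forall c, a < c < b -> derivable_pt id c).
  { intros c _. apply derivable_pt_id. }
  destruct (MVT f id a b pr1 pr2 hab hc) as [c [P E]].
  - intros c _. apply derivable_continuous_pt, derivable_pt_id.
  - exists c; split; [exact P|].
    rewrite (derive_pt_eq_0 f c (df c) (pr1 c P)) in E
      by now apply is_derive_Reals, hd.
    rewrite (derive_pt_eq_0 id c 1 (pr2 c P)) in E by apply derivable_pt_lim_id.
    unfold id in E. lra.
Qed.

Lemma increment_ge (f df : R -> R) (a b l : R) :
  a <= b ->
  (forall x, a < x < b -> is_derive f x (df x) /\ l <= df x) ->
  (forall x, a <= x <= b -> continuity_pt f x) ->
  l * (b - a) <= f b - f a.
Proof.
  intros [hab | ->] hd hc; [|lra].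
  destruct (mvt_open f df a b hab (fun x h => proj1 (hd x h)) hc) as [c [h ->]].
  apply Rmult_le_compat_r; [lra | apply hd, h].
Qed.

Lemma increment_abs_le (f df : R -> R) (a b l : R) :
  a <= b ->
  (forall x, a < x < b -> is_derive f x (df x) /\ Rabs (df x) <= l) ->
  (forall x, a <= x <= b -> continuity_pt f x) ->
  Rabs (f b - f a) <= l * (b - a).
Proof.
  intros [hab | ->] hd hc.
  2: { rewrite !Rminus_diag, Rabs_R0; lra. }
  destruct (mvt_open f df a b hab (fun x h => proj1 (hd x h)) hc) as [c [h ->]].
  rewrite Rabs_mult, (Rabs_right (b - a)) by lra.
  apply Rmult_le_compat_r; [lra | apply hd, h].
Qed.

Lemma continuity_pt_pos (f : R -> R) (t : R) :
  continuity_pt f t -> 0 < f t ->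
  exists d, 0 < d /\ forall s, Rabs (s - t) < d -> 0 < f s.
Proof.
  intros hc hp. destruct (hc (f t) hp) as [d [hd H]].
  exists d; split; [exact hd|]. intros s hs.
  destruct (Req_dec t s) as [<- | ne]; [exact hp|].
  assert (K : Rabs (f s - f t) < f t).
  { apply H. repeat split; [exact ne | exact hs]. }
  apply Rabs_def2 in K. lra.
Qed.

Lemma first_zero (f : R -> R) (a b : R) :
  a < b -> (forall x, continuity_pt f x) -> 0 < f a -> f b <= 0 ->
  exists t, a < t <= b /\ f t = 0 /\ forall s, a <= s < t -> 0 < f s.
Proof.
  intros hab hc ha hb.
  (* The supremum of the initial segments on which [f] stays positive is the zero sought: a positive
     value there would extend the segment, a negative one would already occur to its left. *)
  set (E := fun s => a <= s <= b /\ forall r, a <= r <= s -> 0 < f r).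
  destruct (completeness E) as [t [ub lub]].
  { exists b. intros s [h _]; lra. }
  { exists a. split; [lra|]. intros r hr. now replace r with a by lra. }
  assert (ta : a <= t).
  { apply ub. split; [lra|]. intros r hr. now replace r with a by lra. }
  assert (tb : t <= b) by (apply lub; intros s [h _]; lra).
  assert (below : forall s, a <= s < t -> 0 < f s).
  { intros s hs. apply Rnot_le_lt. intros hf.
    assert (t <= s); [|lra].
    apply lub. intros r [hr hr']. apply Rnot_lt_le. intros hsr.
    specialize (hr' s ltac:(lra)). lra. }
  assert (le0 : f t <= 0).
  { apply Rnot_lt_le. intros hp.
    destruct (continuity_pt_pos f t (hc t) hp) as [d [hd H]].
    assert (t < b) by (destruct tb as [? | ->]; lra).
    set (s := Rmin b (t + d / 2)).
    assert (hs : t < s <= t + d / 2 /\ s <= b).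
    { unfold s, Rmin; destruct Rle_dec; lra. }
    assert (s <= t); [|lra].
    apply ub. split; [lra|]. intros r hr.
    destruct (Rlt_le_dec r t); [apply below; lra|].
    apply H. rewrite Rabs_right; lra. }
  assert (hat : a < t) by (destruct ta as [? | <-]; lra).
  exists t. repeat split; try lra; [|exact below].
  apply Rle_antisym; [exact le0|]. apply Rnot_lt_le. intros hn.
  destruct (continuity_pt_pos (fun x => - f x) t) as [d [hd H]].
  { apply continuity_pt_opp, hc. }
  { lra. }
  set (s := Rmax a (t - d / 2)).
  assert (hs : a <= s < t /\ t - d / 2 <= s).
  { unfold s, Rmax; destruct Rle_dec; lra. }
  specialize (below s ltac:(lra)).
  assert (0 < - f s); [|lra].
  apply H. rewrite Rabs_left; lra.
Qed.

Lemma continuity_pt_reflect (f : R -> R) (x : R) :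
  continuity_pt f (- x) -> continuity_pt (fun t => f (- t)) x.
Proof.
  intros H. apply (continuity_pt_comp (fun t => - t) f); [|exact H].
  apply continuity_pt_opp, derivable_continuous_pt, derivable_pt_id.
Qed.

Lemma last_zero (f : R -> R) (a b : R) :
  a < b -> (forall x, continuity_pt f x) -> f a <= 0 -> 0 < f b ->
  exists t, a <= t < b /\ f t = 0 /\ forall s, t < s <= b -> 0 < f s.
Proof.
  intros hab hc ha hb.
  destruct (first_zero (fun x => f (- x)) (- b) (- a)) as [t [ht [h0 hpos]]].
  - lra.
  - intros x. apply continuity_pt_reflect, hc.
  - now rewrite Ropp_involutive.
  - now rewrite Ropp_involutive.
  - exists (- t). repeat split; try lra. intros s hs.
    rewrite <- (Ropp_involutive s). apply hpos. lra.
Qed.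

(** If [e 1 < 0], then after the last zero [t] of [e] the hypothesis reads [e' >= m e], so
    [e * exp (- m x)] cannot decrease from its value [0] at [t]. *)
Lemma gronwall_nonneg (e de : R -> R) (m : R) :
  (forall x, continuity_pt e x) -> 0 <= e 0 ->
  (forall x, 0 < x < 1 -> is_derive e x (de x) /\ - m * Rabs (e x) <= de x) ->
  0 <= e 1.
Proof.
  intros hc h0 hd. apply Rnot_lt_le. intros hneg.
  destruct (last_zero (fun x => - e x) 0 1) as [t [ht [et hpos]]]; try lra.
  { intros x. apply continuity_pt_opp, hc. }
  set (g := fun x => e x * exp (- m * x)).
  assert (I : 0 * (1 - t) <= g 1 - g t).
  { apply increment_ge with (df := fun x => exp (- m * x) * (de x - m * e x)).
    - lra.
    - intros x hx. destruct (hd x ltac:(lra)) as [D B]. split.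
      + unfold g. apply is_derive_eq with
          (plus (mult (de x) (exp (- m * x))) (mult (e x) (- m * exp (- m * x)))).
        * apply (is_derive_mult (K := R_AbsRing) e (fun x => exp (- m * x)));
            [exact D | | intros; apply Rmult_comm].
          auto_derive; [exact Logic.I | ring].
        * unfold plus, mult; simpl; ring.
      + specialize (hpos x ltac:(lra)). rewrite Rabs_left in B by lra.
        apply Rmult_le_pos; [left; apply exp_pos | lra].
    - intros x _. apply continuity_pt_mult; [apply hc|].
      apply is_derive_continuity_pt with (- m * exp (- m * x)).
      auto_derive; [exact Logic.I | ring]. }
  unfold g in I. replace (e t) with 0 in I by lra.
  pose proof (exp_pos (- m * 1)). nra.
Qed.

(** Here [d] stands for [W x - W (- x)], [phi] for an explicit minorant of the accumulated forcing,
    and [m] for the coefficient of the reversible part. Since [m] is of order [eps^2], the loss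
    [2 m Phi] is negligible against [phi 1]. *)
Lemma gronwall_lower (d dd phi dphi : R -> R) (Phi m : R) :
  (forall x, continuity_pt d x) -> (forall x, continuity_pt phi x) ->
  0 <= d 0 -> phi 0 = 0 -> 0 <= m <= 1 / 2 ->
  (forall x, 0 < x < 1 -> Rabs (phi x) <= Phi) ->
  (forall x, 0 < x < 1 -> is_derive phi x (dphi x)) ->
  (forall x, 0 < x < 1 ->
     is_derive d x (dd x) /\ dphi x - m * Rabs (d x) <= dd x) ->
  phi 1 - 2 * m * Phi <= d 1.
Proof.
  intros hcd hcp d0 p0 hm hPhi hdp hd.
  assert (0 <= Phi).
  { apply Rle_trans with (Rabs (phi (1 / 2))); [apply Rabs_pos | apply hPhi; lra]. }
  (* The linear term pays for replacing [|d|] by [|e| + 2 Phi]; the condition [2 m <= 1] keeps this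
     term itself below [Phi]. *)
  set (e := fun x => d x - phi x + 2 * m * Phi * x).
  assert (N : 0 <= e 1).
  { apply gronwall_nonneg with (de := fun x => dd x - dphi x + 2 * m * Phi) (m := m).
    - intros x. apply continuity_pt_plus; [apply continuity_pt_minus; auto|].
      apply is_derive_continuity_pt with (2 * m * Phi).
      auto_derive; [exact I | ring].
    - unfold e. lra.
    - intros x hx. destruct (hd x hx) as [D B]. split.
      + unfold e. apply (is_derive_plus (K := R_AbsRing) (V := R_NormedModule)
          (fun x => d x - phi x) (fun x => 2 * m * Phi * x)).
        * apply (is_derive_minus (K := R_AbsRing) (V := R_NormedModule)); auto.
        * auto_derive; [exact I | ring].
      + assert (T : Rabs (d x) <= Rabs (e x) + 2 * Phi).
        { replace (d x) with (e x + (phi x - 2 * m * Phi * x)) by (unfold e; ring).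
          eapply Rle_trans; [apply Rabs_triang|].
          apply Rplus_le_compat_l.
          eapply Rle_trans; [apply Rabs_triang|].
          specialize (hPhi x hx). rewrite Rabs_Ropp, (Rabs_right (2 * m * Phi * x)).
          - assert (2 * m * Phi * x <= 1 * Phi * 1); [|lra].
            assert (0 <= m * Phi) by nra. nra.
          - apply Rle_ge. repeat apply Rmult_le_pos; lra. }
        nra. }
  unfold e in N. lra.
Qed.

(** Continuity of [g] makes [g (b + h) - g b] small, and the reciprocal difference quotient of [f]
    at this increment is the difference quotient of [g]. The inverse relation is local because the
    inverse of an arc is exact only over the range of the arc. *)
Lemma is_derive_inverse (f g : R -> R) (b l : R) :
  continuity_pt g b -> locally b (fun z => f (g z) = z) ->
  is_derive f (g b) l -> l <> 0 -> is_derive g b (/ l).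
Proof.
  intros hg [r hr] hf hl.
  assert (fb : f (g b) = b) by (apply hr, ball_center).
  apply is_derive_Reals in hf. apply is_derive_Reals.
  (* The value [/ l] at [0] lets the estimate run over all small [h]; [gne] selects the other branch
     later. *)
  set (q := fun h => if Req_EM_T h 0 then / l else h / (f (g b + h) - f (g b))).
  assert (hq : forall eps, 0 < eps -> exists d, 0 < d /\
            forall h, Rabs h < d -> Rabs (q h - / l) < eps).
  { intros eps he.
    assert (L : 0 < Rabs l) by now apply Rabs_pos_lt.
    (* The first bound keeps the quotient [k] above [|l| / 2] in absolute value, the second then
       makes [|l - k| / |k l|] less than [eps]. *)
    set (e1 := Rmin (Rabs l / 2) (eps * Rabs l * Rabs l / 2)).
    assert (e1pos : 0 < e1).
    { apply Rmin_pos; [lra|]. assert (0 < eps * Rabs l * Rabs l); [|lra].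
      repeat apply Rmult_lt_0_compat; lra. }
    destruct (hf e1 e1pos) as [d hd].
    exists d; split; [apply cond_pos|]. intros h hh. unfold q.
    destruct Req_EM_T as [_ | hne]; [rewrite Rminus_diag, Rabs_R0; lra|].
    specialize (hd h hne hh). set (k := (f (g b + h) - f (g b)) / h) in *.
    assert (K1 : Rabs l / 2 < Rabs k).
    { assert (Rabs (k - l) < Rabs l / 2) by (eapply Rlt_le_trans; [apply hd | apply Rmin_l]).
      assert (Rabs l <= Rabs (l - k) + Rabs k).
      { replace l with ((l - k) + k) at 1 by ring. apply Rabs_triang. }
      rewrite Rabs_minus_sym in H0. lra. }
    assert (k0 : k <> 0) by (intros ->; rewrite Rabs_R0 in K1; lra).
    replace (h / (f (g b + h) - f (g b)) - / l) with ((l - k) / (k * l)).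
    2: { unfold k. field. repeat split; auto. intros E. apply k0. unfold k. rewrite E. field; auto. }
    unfold Rdiv. rewrite Rabs_mult, Rabs_inv, Rabs_mult, Rabs_minus_sym.
    apply Rlt_le_trans with (e1 * / (Rabs k * Rabs l)).
    - apply Rmult_lt_compat_r; [|exact hd]. apply Rinv_0_lt_compat. nra.
    - apply Rle_trans with (eps * Rabs l * Rabs l / 2 * / (Rabs l / 2 * Rabs l)).
      + apply Rmult_le_compat; [lra | left; apply Rinv_0_lt_compat; nra | apply Rmin_r |].
        apply Rinv_le_contravar; nra.
      + right. field. lra. }
  intros eps he. destruct (hq eps he) as [d [dpos hd]].
  destruct (hg d dpos) as [d2 [d2pos hd2]].
  assert (dm : 0 < Rmin d2 r) by (apply Rmin_pos; [exact d2pos | apply cond_pos]).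
  exists (mkposreal _ dm). intros h hne hh. simpl in hh.
  assert (G : f (g (b + h)) = b + h).
  { apply hr. unfold ball; simpl; unfold AbsRing_ball, abs, minus, plus, opp; simpl.
    replace (b + h + - b) with h by ring.
    eapply Rlt_le_trans; [exact hh | apply Rmin_r]. }
  assert (gne : g (b + h) - g b <> 0).
  { intros E. apply hne. assert (g (b + h) = g b) by lra. rewrite H, fb in G. lra. }
  specialize (hd (g (b + h) - g b)). unfold q in hd.
  destruct Req_EM_T as [E | _]; [contradiction|].
  replace (g b + (g (b + h) - g b)) with (g (b + h)) in hd by ring.
  rewrite G, fb in hd. replace (b + h - b) with h in hd by ring.
  apply hd. apply hd2. split; [split; [exact I | lra]|].
  simpl; unfold Rdist. replace (b + h - b) with h by ring.
  eapply Rlt_le_trans; [exact hh | apply Rmin_l].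
Qed.

(** Clamping [z] to the range of [f] makes the inverse total and continuous on the whole line, as
    the everywhere continuous [W] of a half turn requires. *)
Lemma decreasing_inverse (f : R -> R) (t0 t1 : R) :
  t0 < t1 -> continuity f ->
  (forall s t, t0 <= s -> s < t -> t <= t1 -> f t < f s) ->
  exists g : R -> R,
    (forall z, continuity_pt g z) /\ (forall z, t0 <= g z <= t1) /\
    (forall z, f t1 <= z <= f t0 -> f (g z) = z).
Proof.
  intros h01 hc hdec.
  assert (h10 : f t1 < f t0) by (apply hdec; lra).
  set (cl := fun z => Rmax (f t1) (Rmin z (f t0))).
  assert (clb : forall z, f t1 <= cl z <= f t0).
  { intros z. unfold cl, Rmax, Rmin. repeat destruct Rle_dec; lra. }
  assert (cl1 : forall y z, Rabs (cl y - cl z) <= Rabs (y - z)).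
  { intros y z. unfold cl, Rmax, Rmin. repeat destruct Rle_dec;
      unfold Rabs; repeat destruct Rcase_abs; lra. }
  assert (ex : forall z, {t | t0 <= t <= t1 /\ f t - cl z = 0}).
  { intros z. apply (IVT_cor (fun t => f t - cl z)).
    - intros t. apply continuity_pt_minus; [apply hc|].
      apply continuity_pt_const. now intros ? ?.
    - lra.
    - specialize (clb z). nra. }
  set (g := fun z => proj1_sig (ex z)).
  assert (gb : forall z, t0 <= g z <= t1) by (intros z; apply (proj2_sig (ex z))).
  assert (gi : forall z, f (g z) = cl z).
  { intros z. pose proof (proj2 (proj2_sig (ex z))) as H. unfold g. simpl in H. lra. }
  exists g. repeat split; try apply gb.
  2: { intros z hz. rewrite gi. unfold cl. rewrite Rmin_left, Rmax_right; lra. }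
  intros z eps he.
  (* Continuity is read off from monotonicity, one side at a time: either [g z + eps] is beyond
     [t1], or [f] there lies strictly below [cl z], and the 1-Lipschitz clamp needs a definite
     distance to reach it. *)
  assert (A : exists a, 0 < a /\ forall y, Rabs (y - z) < a -> g y < g z + eps).
  { destruct (Rle_lt_dec (g z + eps) t1) as [h | h].
    - exists (cl z - f (g z + eps)). split.
      + rewrite <- gi. enough (f (g z + eps) < f (g z)) by lra.
        apply hdec; [apply gb | lra | exact h].
      + intros y hy. apply Rnot_le_lt. intros [k | k].
        * assert (f (g y) < f (g z + eps)).
          { apply hdec; [specialize (gb z); lra | exact k | apply gb]. }
          rewrite gi in H. specialize (cl1 y z). apply Rabs_def2 in hy.
          unfold Rabs in cl1; repeat destruct Rcase_abs in cl1; lra.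
        * rewrite k, gi in hy. specialize (cl1 y z). apply Rabs_def2 in hy.
          unfold Rabs in cl1; repeat destruct Rcase_abs in cl1; lra.
    - exists 1. split; [lra|]. intros y _. specialize (gb y). lra. }
  assert (B : exists a, 0 < a /\ forall y, Rabs (y - z) < a -> g z - eps < g y).
  { destruct (Rle_lt_dec t0 (g z - eps)) as [h | h].
    - exists (f (g z - eps) - cl z). split.
      + rewrite <- gi. enough (f (g z) < f (g z - eps)) by lra.
        apply hdec; [exact h | lra | apply gb].
      + intros y hy. apply Rnot_le_lt. intros [k | k].
        * assert (f (g z - eps) < f (g y)).
          { apply hdec; [apply gb | exact k | specialize (gb z); lra]. }
          rewrite gi in H. specialize (cl1 y z). apply Rabs_def2 in hy.
          unfold Rabs in cl1; repeat destruct Rcase_abs in cl1; lra.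
        * rewrite <- k, gi in hy. specialize (cl1 y z). apply Rabs_def2 in hy.
          unfold Rabs in cl1; repeat destruct Rcase_abs in cl1; lra.
    - exists 1. split; [lra|]. intros y _. specialize (gb y). lra. }
  destruct A as [a [apos HA]], B as [b [bpos HB]].
  exists (Rmin a b). split; [apply Rmin_pos; lra|].
  intros y [_ hy]. simpl in *. unfold Rdist in *.
  specialize (HA y (Rlt_le_trans _ _ _ hy (Rmin_l _ _))).
  specialize (HB y (Rlt_le_trans _ _ _ hy (Rmin_r _ _))).
  apply Rabs_def1; lra.
Qed.

(** * The rational remainder *)

Ltac mono :=
  match goal with
  | |- 0 <= _ + _ => apply Rplus_le_le_0_compat; mono
  | |- 0 <= _ * _ => apply Rmult_le_pos; mono
  | |- 0 <= _ ^ _ => apply pow_le; mono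
  | |- _ => lra
  end.

Definition den (a w X U : R) : R := (U + w * X) ^ 2 - a ^ 2 * X * U.

(** With [X = x^2] and [U = y^2], [den] is [q(x, y) q(- x, y)], and [rem] is what remains of
    a binary cubic in [X], [U] divided by [den] after the linear quotient is removed. *)
Definition rem (a w p r X U : R) : R := U ^ 2 * (p * X + r * U) / den a w X U.

(** This is the minimum of [den / (U + w X)^2], reached at [U = w X], since
    [4 w X U = (U + w X)^2 - (U - w X)^2]. *)
Definition kap (a w : R) : R := 1 - a ^ 2 / (4 * w).

Lemma kap_pos a w : 0 < w -> a ^ 2 < 4 * w -> 0 < kap a w.
Proof.
  intros hw ha. unfold kap. apply Rlt_0_minus, (Rdiv_lt_1 (a ^ 2)); lra.
Qed.

Lemma den_ge a w X U :
  0 < w -> kap a w * (U + w * X) ^ 2 <= den a w X U.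
Proof.
  intros hw. unfold kap, den.
  replace ((U + w * X) ^ 2 - a ^ 2 * X * U)
    with ((1 - a ^ 2 / (4 * w)) * (U + w * X) ^ 2 + a ^ 2 / (4 * w) * (U - w * X) ^ 2)
    by (field; lra).
  assert (0 <= a ^ 2 / (4 * w)).
  { apply Rdiv_le_0_compat; [apply pow2_ge_0 | lra]. }
  pose proof (pow2_ge_0 (U - w * X)). nra.
Qed.

Lemma den_pos a w X U :
  0 < w -> a ^ 2 < 4 * w -> 0 < U + w * X -> 0 < den a w X U.
Proof.
  intros hw ha h. eapply Rlt_le_trans; [|apply den_ge, hw].
  apply Rmult_lt_0_compat; [now apply kap_pos | now apply pow_lt].
Qed.

Definition rem_cst (a w p r : R) : R := (Rabs p / w + Rabs r) / kap a w.

Lemma rem_cst_nonneg a w p r :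
  0 < w -> a ^ 2 < 4 * w -> 0 <= rem_cst a w p r.
Proof.
  intros hw ha. pose proof (kap_pos a w hw ha). pose proof (Rabs_pos p). pose proof (Rabs_pos r).
  unfold rem_cst. apply Rdiv_le_0_compat; [|lra].
  assert (0 <= Rabs p / w) by (apply Rdiv_le_0_compat; lra). lra.
Qed.

Lemma Rabs_div_le x y z : 0 < y -> Rabs x <= z * y -> Rabs (x / y) <= z.
Proof.
  intros hy h. unfold Rdiv. rewrite Rabs_mult, Rabs_inv, (Rabs_right y) by lra.
  apply Rmult_le_reg_r with y; [exact hy|]. rewrite Rmult_assoc, Rinv_l; lra.
Qed.

(** The quotient by [U + w X] is kept because it records the decay of the remainder away from
    [|x| <= |y|]; the linear bound that follows gives this up. *)
Lemma rem_abs_le a w p r X U :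
  0 < w -> a ^ 2 < 4 * w -> 0 <= X -> 0 <= U -> 0 < U + w * X ->
  Rabs (rem a w p r X U) <= rem_cst a w p r * U ^ 2 / (U + w * X).
Proof.
  intros hw ha hX hU hs. unfold rem.
  pose proof (kap_pos a w hw ha) as hk. pose proof (den_ge a w X U hw) as hd.
  apply Rabs_div_le; [now apply den_pos|].
  rewrite Rabs_mult, (Rabs_right (U ^ 2)) by (apply Rle_ge, pow2_ge_0).
  assert (N : Rabs (p * X + r * U) <= (Rabs p / w + Rabs r) * (U + w * X)).
  { eapply Rle_trans; [apply Rabs_triang|]. rewrite !Rabs_mult, (Rabs_right X), (Rabs_right U) by lra.
    replace ((Rabs p / w + Rabs r) * (U + w * X))
      with (Rabs p * X + Rabs r * U + (Rabs p * (/ w) * U + Rabs r * (w * X))) by (field; lra).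
    pose proof (Rabs_pos p). pose proof (Rabs_pos r).
    assert (0 < / w) by now apply Rinv_0_lt_compat.
    assert (0 <= Rabs p * / w * U) by (repeat apply Rmult_le_pos; lra).
    assert (0 <= Rabs r * (w * X)) by (repeat apply Rmult_le_pos; lra). lra. }
  apply Rle_trans with (U ^ 2 * ((Rabs p / w + Rabs r) * (U + w * X))).
  { apply Rmult_le_compat_l; [apply pow2_ge_0 | exact N]. }
  replace (U ^ 2 * ((Rabs p / w + Rabs r) * (U + w * X)))
    with (rem_cst a w p r * U ^ 2 / (U + w * X) * (kap a w * (U + w * X) ^ 2))
    by (unfold rem_cst; field; lra).
  apply Rmult_le_compat_l; [|exact hd].
  apply Rdiv_le_0_compat; [|exact hs].
  apply Rmult_le_pos; [now apply rem_cst_nonneg | apply pow2_ge_0].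
Qed.

Lemma rem_abs_le_linear a w p r X U :
  0 < w -> a ^ 2 < 4 * w -> 0 <= X -> 0 <= U -> 0 < U + w * X ->
  Rabs (rem a w p r X U) <= rem_cst a w p r * U.
Proof.
  intros hw ha hX hU hs. eapply Rle_trans; [now apply rem_abs_le|].
  replace (rem_cst a w p r * U) with
    (rem_cst a w p r * U * (U + w * X) / (U + w * X)) by (field; lra).
  apply Rmult_le_compat_r; [left; now apply Rinv_0_lt_compat|].
  pose proof (rem_cst_nonneg a w p r hw ha).
  assert (0 <= rem_cst a w p r * U * (w * X)).
  { apply Rmult_le_pos; apply Rmult_le_pos; lra. }
  simpl; lra.
Qed.

Definition lip_cst (a w p r : R) : R :=
  2 * (Rabs p / w * (1 + Rabs (2 * w - a ^ 2) / w)
       + Rabs r * (1 + Rabs (2 * w - a ^ 2) / w + 1)) / kap a w ^ 2.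

Lemma lip_cst_nonneg a w p r :
  0 < w -> a ^ 2 < 4 * w -> 0 <= lip_cst a w p r.
Proof.
  intros hw ha. pose proof (kap_pos a w hw ha). pose proof (Rabs_pos p). pose proof (Rabs_pos r).
  unfold lip_cst.
  assert (0 <= Rabs (2 * w - a ^ 2) / w) by (apply Rdiv_le_0_compat; [apply Rabs_pos | lra]).
  assert (0 <= Rabs p / w) by (apply Rdiv_le_0_compat; lra).
  apply Rdiv_le_0_compat; [|now apply pow_lt].
  assert (0 <= Rabs p / w * (1 + Rabs (2 * w - a ^ 2) / w)) by (apply Rmult_le_pos; lra).
  assert (0 <= Rabs r * (1 + Rabs (2 * w - a ^ 2) / w + 1)) by (apply Rmult_le_pos; lra).
  lra.
Qed.

(** With [Z = w X], the difference is [U - V] times a combination of five quartic forms, over the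
    two denominators. Each form vanishes at [U = V = 0], which saves the factor
    [(U + V) / (U + w X + (V + w X))]; it is small where [w X] dominates. The number [n] is the
    middle coefficient of [den]. *)
Lemma rem_lipschitz a w p r X U V :
  0 < w -> a ^ 2 < 4 * w -> 0 <= X -> 0 <= U -> 0 <= V ->
  0 < U + w * X -> 0 < V + w * X ->
  Rabs (rem a w p r X U - rem a w p r X V)
  <= lip_cst a w p r * (Rabs (U - V) * ((U + V) / (U + w * X + (V + w * X)))).
Proof.
  intros hw ha hX hU hV hsU hsV.
  pose proof (kap_pos a w hw ha) as hk.
  pose proof (den_pos a w X U hw ha hsU) as dU.
  pose proof (den_pos a w X V hw ha hsV) as dV.
  set (n := 2 * w - a ^ 2).
  set (Z := w * X). assert (hZ : 0 <= Z) by (apply Rmult_le_pos; lra).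
  set (M1 := Z ^ 3 * (U + V)). set (M2 := Z ^ 2 * U * V).
  set (M3 := Z ^ 2 * (U ^ 2 + U * V + V ^ 2)).
  set (M4 := Z * U * V * (U + V)). set (M5 := U ^ 2 * V ^ 2).
  assert (E : rem a w p r X U - rem a w p r X V =
    (U - V) * (p / w * (M1 + n / w * M2) + r * (M3 + n / w * M4 + M5))
     / (den a w X U * den a w X V)).
  { unfold rem, M1, M2, M3, M4, M5, n, Z. unfold den in *. field. lra. }
  rewrite E.
  set (S := U + Z + (V + Z)). set (B := 2 * ((U + V) / S) * ((U + Z) ^ 2 * (V + Z) ^ 2)).
  assert (hS : 0 < S) by (unfold S, Z; lra).
  (* Once denominators are cleared, right minus left expands for each form into a polynomial with
     nonnegative coefficients, which [mono] recognizes. *)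
  assert (bnd : forall M, 0 <= M -> M * S <= 2 * (U + V) * ((U + Z) ^ 2 * (V + Z) ^ 2) -> 0 <= M <= B).
  { intros M hM h. split; [exact hM|]. unfold B.
    apply Rmult_le_reg_r with S; [exact hS|].
    replace (2 * ((U + V) / S) * ((U + Z) ^ 2 * (V + Z) ^ 2) * S)
      with (2 * (U + V) * ((U + Z) ^ 2 * (V + Z) ^ 2)) by (field; lra). exact h. }
  assert (poly : forall x y, 0 <= y - x -> x <= y) by (intros; lra).
  assert (b1 : 0 <= M1 <= B).
  { apply bnd; unfold M1, S.
    - apply Rmult_le_pos; [now apply pow_le | lra].
    - apply poly. ring_simplify. mono. }
  assert (b2 : 0 <= M2 <= B).
  { apply bnd; unfold M2, S; [mono|]. apply poly. ring_simplify. mono. }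
  assert (b3 : 0 <= M3 <= B).
  { apply bnd; unfold M3, S; [mono|]. apply poly. ring_simplify. mono. }
  assert (b4 : 0 <= M4 <= B).
  { apply bnd; unfold M4, S; [mono|]. apply poly. ring_simplify. mono. }
  assert (b5 : 0 <= M5 <= B).
  { apply bnd; unfold M5, S; [mono|]. apply poly. ring_simplify. mono. }
  apply Rabs_div_le; [now apply Rmult_lt_0_compat|].
  rewrite Rabs_mult.
  set (c := Rabs p / w * (1 + Rabs n / w) + Rabs r * (1 + Rabs n / w + 1)).
  assert (hn : 0 <= Rabs n / w) by (apply Rdiv_le_0_compat; [apply Rabs_pos | lra]).
  assert (hp : 0 <= Rabs p / w) by (apply Rdiv_le_0_compat; [apply Rabs_pos | lra]).
  assert (hr : 0 <= Rabs r) by apply Rabs_pos.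
  assert (hc : 0 <= c).
  { unfold c. apply Rplus_le_le_0_compat; apply Rmult_le_pos; lra. }
  assert (P : Rabs (p / w * (M1 + n / w * M2) + r * (M3 + n / w * M4 + M5)) <= c * B).
  { assert (aw : forall x, Rabs (x / w) = Rabs x / w).
    { intros x. unfold Rdiv. rewrite Rabs_mult, Rabs_inv, (Rabs_right w) by lra. reflexivity. }
    assert (am : forall x M, 0 <= M <= B -> Rabs (x * M) <= Rabs x * B).
    { intros x M hM. rewrite Rabs_mult, (Rabs_right M) by lra.
      apply Rmult_le_compat_l; [apply Rabs_pos | lra]. }
    assert (q1 : Rabs (M1 + n / w * M2) <= (1 + Rabs n / w) * B).
    { eapply Rle_trans; [apply Rabs_triang|]. pose proof (am (n / w) M2 b2) as h.
      rewrite aw in h. rewrite (Rabs_right M1) by lra. lra. }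
    assert (q2 : Rabs (M3 + n / w * M4 + M5) <= (1 + Rabs n / w + 1) * B).
    { eapply Rle_trans; [apply Rabs_triang|]. rewrite (Rabs_right M5) by lra.
      eapply Rle_trans; [apply Rplus_le_compat_r, Rabs_triang|].
      pose proof (am (n / w) M4 b4) as h.
      rewrite aw in h. rewrite (Rabs_right M3) by lra. lra. }
    eapply Rle_trans; [apply Rabs_triang|].
    rewrite !Rabs_mult, aw. unfold c. rewrite Rmult_plus_distr_r, !Rmult_assoc.
    apply Rplus_le_compat; (apply Rmult_le_compat_l; [lra | assumption]). }
  apply Rle_trans with (Rabs (U - V) * (c * B)).
  { apply Rmult_le_compat_l; [apply Rabs_pos | exact P]. }
  replace (Rabs (U - V) * (c * B)) with
    (lip_cst a w p r * (Rabs (U - V) * ((U + V) / S))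
     * ((kap a w * (U + Z) ^ 2) * (kap a w * (V + Z) ^ 2))).
  2: { unfold lip_cst, c, B, n. field. lra. }
  apply Rmult_le_compat_l.
  - apply Rmult_le_pos; [now apply lip_cst_nonneg|].
    apply Rmult_le_pos; [apply Rabs_pos|]. apply Rdiv_le_0_compat; lra.
  - apply Rmult_le_compat; try (apply den_ge, hw); apply Rmult_le_pos;
      try apply pow2_ge_0; lra.
Qed.

Lemma rem_lipschitz_linear a w p r X U V :
  0 < w -> a ^ 2 < 4 * w -> 0 <= X -> 0 <= U -> 0 <= V ->
  0 < U + w * X -> 0 < V + w * X ->
  Rabs (rem a w p r X U - rem a w p r X V) <= lip_cst a w p r * Rabs (U - V).
Proof.
  intros hw ha hX hU hV hsU hsV. eapply Rle_trans; [now apply rem_lipschitz|].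
  apply Rmult_le_compat_l; [now apply lip_cst_nonneg|].
  rewrite <- (Rmult_1_r (Rabs (U - V))) at 2.
  apply Rmult_le_compat_l; [apply Rabs_pos|].
  assert (0 <= w * X) by (apply Rmult_le_pos; lra).
  apply Rle_div_l; lra.
Qed.

(** * Half turns as scalar equations *)

Definition small (P : R -> Prop) : Prop :=
  exists e0, 0 < e0 /\ forall eps, 0 < eps < e0 -> P eps.

Lemma small_and (P Q : R -> Prop) :
  small P -> small Q -> small (fun e => P e /\ Q e).
Proof.
  intros [e1 [h1 H1]] [e2 [h2 H2]]. exists (Rmin e1 e2).
  split; [now apply Rmin_pos|]. intros e he.
  pose proof (Rmin_l e1 e2). pose proof (Rmin_r e1 e2).
  split; [apply H1 | apply H2]; lra.
Qed.

Lemma small_imp (P Q : R -> Prop) :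
  small P -> (forall e, 0 < e -> P e -> Q e) -> small Q.
Proof.
  intros [e1 [h1 H1]] H. exists e1. split; [exact h1|].
  intros e he. apply H; [lra | now apply H1].
Qed.

Lemma small_mult (c C : R) : 0 < c -> small (fun e => e * C < c).
Proof.
  intros hc. pose proof (Rabs_pos C). exists (c / (Rabs C + 1)).
  split; [apply Rdiv_lt_0_compat; lra|]. intros e he.
  assert (e * (Rabs C + 1) < c) by (apply Rlt_div_r; lra).
  pose proof (Rle_abs C). nra.
Qed.

(** This is the shape of [- Q / q]: the first summand is odd in [x], the second even. Its value at
    [y = 0] comes from [x^3 / w] alone. *)
Definition slope (a w e1 p1 r1 al be ga de x y : R) : R :=
  - x * (x ^ 2 / w + e1 * y ^ 2 + rem a w p1 r1 (x ^ 2) (y ^ 2))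
  + y * (al * x ^ 2 + be * y ^ 2 + rem a w ga de (x ^ 2) (y ^ 2)).

(** [W z = y^2 / c^4] along the arc above [x = c z], where [eps = c]; the scaled ordinate is
    [y / c^2 = sqrt (W z)]. *)
Definition half_turn (F : R -> R -> R) (eps : R) (W : R -> R) : Prop :=
  (forall x, continuity_pt W x) /\ W 1 = 0 /\ 0 <= W (-1) /\
  (forall x, -1 < x < 1 -> 0 < W x) /\
  (forall x, -1 < x < 1 -> is_derive W x (2 * F x (eps * sqrt (W x)))).

Lemma slope_bound a w e1 p1 r1 al be ga de x y :
  0 < w -> a ^ 2 < 4 * w -> 0 < y ->
  Rabs (slope a w e1 p1 r1 al be ga de x y + x ^ 3 / w)
  <= (Rabs e1 + rem_cst a w p1 r1) * (Rabs x * y ^ 2)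
     + y * (Rabs al * x ^ 2 + (Rabs be + rem_cst a w ga de) * y ^ 2).
Proof.
  intros hw ha hy.
  assert (hx : 0 <= x ^ 2) by apply pow2_ge_0.
  assert (hy2 : 0 < y ^ 2) by now apply pow_lt.
  assert (hs : 0 < y ^ 2 + w * x ^ 2).
  { assert (0 <= w * x ^ 2) by (apply Rmult_le_pos; lra). lra. }
  pose proof (rem_abs_le_linear a w p1 r1 (x ^ 2) (y ^ 2) hw ha hx ltac:(lra) hs) as h1.
  pose proof (rem_abs_le_linear a w ga de (x ^ 2) (y ^ 2) hw ha hx ltac:(lra) hs) as h2.
  unfold slope.
  set (R1 := rem a w p1 r1 _ _) in *. set (R2 := rem a w ga de _ _) in *.
  replace (- x * (x ^ 2 / w + e1 * y ^ 2 + R1) + y * (al * x ^ 2 + be * y ^ 2 + R2) + x ^ 3 / w)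
    with (- x * (e1 * y ^ 2 + R1) + y * (al * x ^ 2 + (be * y ^ 2 + R2))) by (field; lra).
  eapply Rle_trans; [apply Rabs_triang|]. rewrite !(Rabs_mult (- x)), !(Rabs_mult y), Rabs_Ropp.
  rewrite (Rabs_right y) by lra.
  apply Rplus_le_compat.
  - replace ((Rabs e1 + rem_cst a w p1 r1) * (Rabs x * y ^ 2))
      with (Rabs x * (Rabs e1 * y ^ 2 + rem_cst a w p1 r1 * y ^ 2)) by ring.
    apply Rmult_le_compat_l; [apply Rabs_pos|].
    eapply Rle_trans; [apply Rabs_triang|].
    rewrite (Rabs_mult e1), (Rabs_right (y ^ 2)) by lra. lra.
  - apply Rmult_le_compat_l; [lra|].
    eapply Rle_trans; [apply Rabs_triang|].
    rewrite (Rabs_mult al), (Rabs_right (x ^ 2)) by lra.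
    apply Rplus_le_compat_l.
    eapply Rle_trans; [apply Rabs_triang|].
    rewrite (Rabs_mult be), (Rabs_right (y ^ 2)) by lra. lra.
Qed.

(** At [eps = 0] the equation is [W' = - 2 x^3 / w], with solution [(1 - x^4) / (2 w)]; a factor 2
    is left on either side. The function [H] is therefore almost constant, but its derivative is
    controlled only where [W <= / w], so the upper bound has to be secured before the lower one. *)
Lemma half_turn_bounds a w e1 p1 r1 al be ga de :
  0 < w -> a ^ 2 < 4 * w ->
  small (fun eps => forall W,
    half_turn (slope a w e1 p1 r1 al be ga de) eps W ->
    forall x, -1 <= x <= 1 -> (1 - x ^ 4) / (4 * w) <= W x <= / w).
Proof.
  intros hw ha.
  set (A := / w). assert (hA : 0 < A) by now apply Rinv_0_lt_compat.
  set (sA := sqrt A). assert (hsA : 0 < sA) by now apply sqrt_lt_R0.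
  set (k1 := Rabs e1 + rem_cst a w p1 r1). set (k2 := Rabs be + rem_cst a w ga de).
  assert (hk1 : 0 <= k1).
  { apply Rplus_le_le_0_compat; [apply Rabs_pos | now apply rem_cst_nonneg]. }
  assert (hk2 : 0 <= k2).
  { apply Rplus_le_le_0_compat; [apply Rabs_pos | now apply rem_cst_nonneg]. }
  set (C := 2 * (k1 * A + sA * (Rabs al + k2 * A))).
  pose proof (Rabs_pos al) as hal.
  assert (hC : 0 <= C) by (unfold C; mono).
  assert (hwC : 0 <= w * C) by mono.
  (* This threshold gives [eps < 1] and [eps * C <= / (4 * w)] at once. *)
  exists (/ (1 + 4 * (w * C))). split; [apply Rinv_0_lt_compat; lra|].
  intros eps [he he'] W [hc [h1 [hm1 [hpos hd]]]].
  assert (small : eps * (1 + 4 * (w * C)) < 1).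
  { apply Rmult_lt_reg_r with (/ (1 + 4 * (w * C))); [apply Rinv_0_lt_compat; lra|].
    rewrite Rmult_assoc, Rinv_r by lra. lra. }
  assert (e1' : eps < 1).
  { assert (0 <= eps * (4 * (w * C))) by mono. lra. }
  assert (small' : eps * C <= / (4 * w)).
  { apply Rmult_le_reg_l with (4 * w); [lra|]. rewrite Rinv_r by lra. lra. }
  set (H := fun x => W x + x ^ 4 / (2 * w)).
  set (dH := fun x => 2 * (slope a w e1 p1 r1 al be ga de x (eps * sqrt (W x)) + x ^ 3 / w)).
  assert (hcH : forall x, continuity_pt H x).
  { intros x. apply continuity_pt_plus; [apply hc|].
    apply is_derive_continuity_pt with (4 * x ^ 3 / (2 * w)). auto_derive; [lra | field; lra]. }
  assert (hdH : forall x, -1 < x < 1 -> is_derive H x (dH x)).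
  { intros x hx. unfold H, dH. eapply is_derive_eq.
    - apply (is_derive_plus (K := R_AbsRing) (V := R_NormedModule) W (fun x => x ^ 4 / (2 * w)));
        [apply hd, hx | auto_derive; [lra | reflexivity]].
    - unfold plus; simpl. field; lra. }
  assert (bH : forall x, -1 < x < 1 -> W x <= A -> Rabs (dH x) <= eps * C).
  { intros x hx hWA. unfold dH. rewrite Rabs_mult, (Rabs_right 2) by lra.
    pose proof (hpos x hx) as hW.
    assert (hq : 0 < sqrt (W x)) by now apply sqrt_lt_R0.
    assert (hqA : sqrt (W x) <= sA) by now apply sqrt_le_1_alt.
    set (y := eps * sqrt (W x)) in *.
    assert (hy : 0 < y) by (apply Rmult_lt_0_compat; lra).
    assert (hye : y <= eps * sA) by (apply Rmult_le_compat_l; lra).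
    assert (hy2 : y ^ 2 <= eps * A).
    { unfold y. rewrite Rpow_mult_distr, pow2_sqrt by lra.
      apply Rmult_le_compat; [apply pow2_ge_0 | lra | nra | lra]. }
    assert (hy2' : y ^ 2 <= A) by nra.
    assert (y20 : 0 <= y ^ 2) by apply pow2_ge_0.
    assert (hx1 : Rabs x <= 1) by (apply Rabs_le; lra).
    assert (hx2 : x ^ 2 <= 1) by nra.
    pose proof (slope_bound a w e1 p1 r1 al be ga de x y hw ha hy) as B.
    fold k1 k2 in B.
    assert (B1 : k1 * (Rabs x * y ^ 2) <= k1 * (eps * A)).
    { apply Rmult_le_compat_l; [lra|]. pose proof (Rabs_pos x). nra. }
    assert (B2 : y * (Rabs al * x ^ 2 + k2 * y ^ 2) <= eps * sA * (Rabs al + k2 * A)).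
    { apply Rmult_le_compat; [lra | | lra |].
      - pose proof (pow2_ge_0 x). mono.
      - apply Rplus_le_compat; [|now apply Rmult_le_compat_l].
        rewrite <- (Rmult_1_r (Rabs al)) at 2. now apply Rmult_le_compat_l. }
    unfold C. lra. }
  (* At the last [t] with [W t = A], [H t] exceeds [H 1 = A / 2] by at least [A / 2], while on
     [[t, 1]] the bound on [dH] is available and allows a variation of less than [A / 2]. *)
  assert (up : forall x, -1 <= x <= 1 -> W x < A).
  { intros x0 hx0. apply Rnot_le_lt. intros hbig.
    assert (x0 < 1).
    { destruct hx0 as [_ [? | ->]]; [assumption | lra]. }
    destruct (last_zero (fun x => A - W x) x0 1) as [t [ht [et hlt]]]; try lra.
    { intros x. apply continuity_pt_minus; [|apply hc].
      apply continuity_pt_const. now intros ? ?. }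
    pose proof (increment_abs_le H dH t 1 (eps * C)) as I.
    assert (J : Rabs (H 1 - H t) <= eps * C * (1 - t)).
    { apply I; [lra | |intros; apply hcH].
      intros x hx. split; [apply hdH; lra|]. apply bH; [lra|].
      specialize (hlt x ltac:(lra)). lra. }
    unfold H in J. rewrite h1 in J. replace (W t) with A in J by lra.
    assert (0 <= t ^ 4 / (2 * w)).
    { apply Rdiv_le_0_compat; [replace (t ^ 4) with ((t ^ 2) ^ 2) by ring; apply pow2_ge_0 | lra]. }
    assert (eA : A = 4 * / (4 * w)) by (unfold A; field; lra).
    assert (eB : 1 ^ 4 / (2 * w) = 2 * / (4 * w)) by (field; lra).
    rewrite eB in J. rewrite Rabs_left in J.
    2: { assert (0 < / (4 * w)) by (apply Rinv_0_lt_compat; lra). lra. }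
    assert (0 <= eps * C) by mono.
    assert (eps * C * (1 - t) <= eps * C * 2) by (apply Rmult_le_compat_l; lra).
    assert (eps * C * 2 < 2 * / (4 * w)); [|lra].
    enough (eps * C < / (4 * w)) by lra.
    apply Rmult_lt_reg_l with (4 * w); [lra|]. rewrite Rinv_r by lra. lra. }
  (* The error of [H] counted from the nearer end is [eps * C * (1 - |x|)], which this absorbs into
     the main term. At the end [-1] the sign [0 <= W (-1)] suffices. *)
  assert (quart : forall x, 0 <= x <= 1 -> 1 - x <= 1 - x ^ 4).
  { intros x hx. assert (0 <= x ^ 3 <= 1) by (split; [apply pow_le; lra |
      rewrite <- (pow1 3); apply pow_incr; lra]).
    replace (x ^ 4) with (x * x ^ 3) by ring. nra. }
  assert (inv4 : forall z, z / (4 * w) = z * / (4 * w)) by reflexivity.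
  assert (inv2 : forall z, z / (2 * w) = 2 * (z * / (4 * w))) by (intros; field; lra).
  assert (i4 : 0 < / (4 * w)) by (apply Rinv_0_lt_compat; lra).
  intros x hx. split; [|left; now apply up].
  destruct (Rle_lt_dec 0 x) as [h0 | h0].
  - assert (J : Rabs (H 1 - H x) <= eps * C * (1 - x)).
    { apply increment_abs_le with (df := dH); [lra | |intros; apply hcH].
      intros z hz. split; [apply hdH; lra|]. apply bH; [lra|]. left. apply up. lra. }
    unfold H in J. rewrite h1 in J. apply Rabs_le_between in J.
    rewrite !inv2, pow1 in J. rewrite inv4. specialize (quart x ltac:(lra)).
    assert (eps * C * (1 - x) <= / (4 * w) * (1 - x ^ 4)).
    { apply Rmult_le_compat; lra || mono. }
    lra.
  - assert (J : Rabs (H x - H (-1)) <= eps * C * (x - -1)).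
    { apply increment_abs_le with (df := dH); [lra | |intros; apply hcH].
      intros z hz. split; [apply hdH; lra|]. apply bH; [lra|]. left. apply up. lra. }
    unfold H in J. apply Rabs_le_between in J.
    rewrite !inv2 in J. replace ((-1) ^ 4) with 1 in J by ring.
    rewrite inv4. specialize (quart (- x) ltac:(lra)).
    replace ((- x) ^ 4) with (x ^ 4) in quart by ring.
    assert (eps * C * (x - -1) <= / (4 * w) * (1 - x ^ 4)).
    { apply Rmult_le_compat; lra || mono. }
    lra.
Qed.

(** The part of [slope] that is even in [x]. *)
Definition par (a w al be ga de x y : R) : R :=
  y * (al * x ^ 2 + be * y ^ 2 + rem a w ga de (x ^ 2) (y ^ 2)).

(** In the derivative of [W x - W (- x)] the odd part survives only as the difference of its values
    at two ordinates, which the Lipschitz bound makes [O(eps^2 |W x - W (- x)|)]. As the final value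
    is [- W (-1) <= 0], a test function [phi] that accumulates less than the even part must end
    below a second-order error. Each order below chooses its own [phi]. *)
Lemma half_turn_compare a w e1 p1 r1 al be ga de eps W (phi dphi : R -> R) Phi :
  0 < w -> a ^ 2 < 4 * w -> 0 < eps ->
  half_turn (slope a w e1 p1 r1 al be ga de) eps W ->
  eps ^ 2 * (2 * (Rabs e1 + lip_cst a w p1 r1)) <= 1 / 2 ->
  (forall x, continuity_pt phi x) -> phi 0 = 0 ->
  (forall x, 0 < x < 1 -> Rabs (phi x) <= Phi) ->
  (forall x, 0 < x < 1 -> is_derive phi x (dphi x)) ->
  (forall x, 0 < x < 1 ->
     dphi x <= 2 * (par a w al be ga de x (eps * sqrt (W x))
                    + par a w al be ga de x (eps * sqrt (W (- x))))) ->
  phi 1 <= 2 * (eps ^ 2 * (2 * (Rabs e1 + lip_cst a w p1 r1))) * Phi.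
Proof.
  intros hw ha he [hc [h1 [hm1 [hpos hd]]]] hm hcp p0 hPhi hdp hb.
  set (L := Rabs e1 + lip_cst a w p1 r1) in *. set (m := eps ^ 2 * (2 * L)) in *.
  assert (hL : 0 <= L).
  { apply Rplus_le_le_0_compat; [apply Rabs_pos | now apply lip_cst_nonneg]. }
  set (F := slope a w e1 p1 r1 al be ga de) in *.
  set (d := fun x => W x - W (- x)).
  assert (d1 : d 1 = - W (-1)) by (unfold d; rewrite h1; change (-(1)) with (-1); ring).
  enough (phi 1 - 2 * m * Phi <= d 1) by lra.
  apply gronwall_lower with (dphi := dphi)
    (dd := fun x => 2 * F x (eps * sqrt (W x)) + 2 * F (- x) (eps * sqrt (W (- x)))); auto.
  - intros x. apply continuity_pt_minus; [apply hc|]. apply continuity_pt_reflect, hc.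
  - unfold d. rewrite Ropp_0. lra.
  - split; [|exact hm]. unfold m. assert (0 <= eps ^ 2) by apply pow2_ge_0. mono.
  - intros x hx. split.
    + unfold d. eapply is_derive_eq.
      * apply (is_derive_minus (K := R_AbsRing) (V := R_NormedModule) W (fun x => W (- x)));
          [apply hd; lra|].
        apply (is_derive_comp W (fun x => - x)); [apply hd; lra|].
        auto_derive; [exact I | reflexivity].
      * unfold minus, plus, opp, scal; simpl. unfold mult; simpl. ring.
    + specialize (hb x hx). pose proof (hpos x ltac:(lra)) as hu.
      pose proof (hpos (- x) ltac:(lra)) as hv.
      set (U := (eps * sqrt (W x)) ^ 2). set (V := (eps * sqrt (W (- x))) ^ 2).
      assert (eU : U = eps ^ 2 * W x) by (unfold U; rewrite Rpow_mult_distr, pow2_sqrt; lra).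
      assert (eV : V = eps ^ 2 * W (- x)) by (unfold V; rewrite Rpow_mult_distr, pow2_sqrt; lra).
      assert (he2 : 0 < eps ^ 2) by now apply pow_lt.
      assert (hU : 0 < U) by (rewrite eU; now apply Rmult_lt_0_compat).
      assert (hV : 0 < V) by (rewrite eV; now apply Rmult_lt_0_compat).
      assert (hX : 0 <= w * x ^ 2) by (pose proof (pow2_ge_0 x); mono).
      pose proof (rem_lipschitz_linear a w p1 r1 (x ^ 2) U V hw ha
        (pow2_ge_0 x) ltac:(lra) ltac:(lra) ltac:(lra) ltac:(lra)) as hl.
      set (D := e1 * (U - V) + (rem a w p1 r1 (x ^ 2) U - rem a w p1 r1 (x ^ 2) V)).
      assert (hD : Rabs D <= L * (eps ^ 2 * Rabs (d x))).
      { replace (eps ^ 2 * Rabs (d x)) with (Rabs (U - V)).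
        - unfold D, L. rewrite Rmult_plus_distr_r, <- Rabs_mult.
          eapply Rle_trans; [apply Rabs_triang|]. now apply Rplus_le_compat_l.
        - replace (U - V) with (eps ^ 2 * d x) by (rewrite eU, eV; unfold d; ring).
          now rewrite Rabs_mult, (Rabs_right (eps ^ 2)) by lra. }
      (* The term [x^3 / w] cancels between [x] and [- x]; [D] is what remains of the odd part. *)
      assert (E : F x (eps * sqrt (W x)) + F (- x) (eps * sqrt (W (- x)))
        = - x * D + par a w al be ga de x (eps * sqrt (W x))
          + par a w al be ga de x (eps * sqrt (W (- x)))).
      { unfold F, slope, par, D. fold U V. replace ((- x) ^ 2) with (x ^ 2) by ring. ring. }
      assert (xD : - x * D >= - (L * (eps ^ 2 * Rabs (d x)))).
      { pose proof (Rabs_pos D). apply Rabs_le_between in hD.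
        assert (x * D <= L * (eps ^ 2 * Rabs (d x))); [|lra].
        destruct (Rle_lt_dec 0 D); nra. }
      unfold m. lra.
Qed.

(** * Excluding half turns by the sign of the first nonzero coefficient *)

Lemma sqrt_lower w W x :
  0 < w -> -1 <= x <= 1 -> (1 - x ^ 4) / (4 * w) <= W ->
  sqrt (/ (4 * w)) * (1 - x ^ 2) <= sqrt W.
Proof.
  intros hw hx hW.
  assert (hx2 : 0 <= x ^ 2 <= 1) by (split; [apply pow2_ge_0 | nra]).
  assert (hl : 0 < / (4 * w)) by (apply Rinv_0_lt_compat; lra).
  (* Since [(1 - x^2)^2 <= 1 - x^4] on [[-1, 1]], the square root is minorized by a polynomial,
     which can be integrated explicitly. *)
  rewrite <- (sqrt_pow2 (1 - x ^ 2)) by lra. rewrite <- sqrt_mult by (lra || apply pow2_ge_0).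
  apply sqrt_le_1_alt. eapply Rle_trans; [|exact hW].
  unfold Rdiv. rewrite Rmult_comm. apply Rmult_le_compat_r; [lra|]. nra.
Qed.

Lemma par_bound a w al be ga de x y :
  0 < w -> a ^ 2 < 4 * w -> 0 < y ->
  Rabs (par a w al be ga de x y - (al * x ^ 2 * y + be * y ^ 3))
  <= rem_cst a w ga de * (y ^ 5 / (y ^ 2 + w * x ^ 2)).
Proof.
  intros hw ha hy. unfold par.
  assert (hX : 0 <= w * x ^ 2) by (pose proof (pow2_ge_0 x); mono).
  assert (hy2 : 0 < y ^ 2) by now apply pow_lt.
  pose proof (rem_abs_le a w ga de (x ^ 2) (y ^ 2) hw ha (pow2_ge_0 x) ltac:(lra) ltac:(lra)) as h.
  set (R := rem a w ga de _ _) in *.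
  replace (y * (al * x ^ 2 + be * y ^ 2 + R) - (al * x ^ 2 * y + be * y ^ 3)) with (y * R) by ring.
  rewrite Rabs_mult, (Rabs_right y) by lra.
  replace (rem_cst a w ga de * (y ^ 5 / (y ^ 2 + w * x ^ 2)))
    with (y * (rem_cst a w ga de * (y ^ 2) ^ 2 / (y ^ 2 + w * x ^ 2))) by (field; lra).
  apply Rmult_le_compat_l; lra.
Qed.

(** The [al] term contributes a positive multiple of [eps]; the rest of the even part is
    [O(y^3) = O(eps^3)], and so is the Gronwall error. *)
Lemma no_half_turn_order1 a w e1 p1 r1 al be ga de :
  0 < w -> a ^ 2 < 4 * w -> 0 < al ->
  small (fun eps => forall W, ~ half_turn (slope a w e1 p1 r1 al be ga de) eps W).
Proof.
  intros hw ha hal.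
  set (L := 2 * (Rabs e1 + lip_cst a w p1 r1)).
  assert (hL : 0 <= L).
  { pose proof (Rabs_pos e1). pose proof (lip_cst_nonneg a w p1 r1 hw ha). unfold L; lra. }
  set (lam := sqrt (/ (4 * w))).
  assert (hlam : 0 < lam) by (apply sqrt_lt_R0, Rinv_0_lt_compat; lra).
  set (sA := sqrt (/ w)).
  assert (hsA : 0 < sA) by (apply sqrt_lt_R0, Rinv_0_lt_compat; lra).
  set (k := Rabs be + rem_cst a w ga de).
  assert (hk : 0 <= k).
  { apply Rplus_le_le_0_compat; [apply Rabs_pos | now apply rem_cst_nonneg]. }
  set (c := k * sA ^ 3). assert (hc : 0 <= c) by (unfold c; mono).
  set (P := 2 * (al * lam) + 4 * c).
  assert (hal' : 0 < al * lam) by now apply Rmult_lt_0_compat.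
  assert (hP : 0 <= P) by (unfold P; lra).
  eapply small_imp.
  { apply small_and; [exact (half_turn_bounds a w e1 p1 r1 al be ga de hw ha)|].
    apply small_and; [apply (small_mult 1 1); lra|].
    apply small_and; [apply (small_mult (1 / 2) L); lra|].
    (* [8 / 15 = 4 (1/3 - 1/5)] is the polynomial part of the test function at [1]. The factor 4
       collects the 2 in the equation for [W] and the two abscissas [x] and [- x]. *)
    apply (small_mult (8 / 15 * (al * lam)) (4 * c + 2 * L * P)); lra. }
  cbv beta. intros eps he [hb [s1 [s2 s3]]] W hW.
  assert (B : forall x, -1 <= x <= 1 -> (1 - x ^ 4) / (4 * w) <= W x <= / w) by now apply hb.
  clear hb.
  assert (e2 : eps ^ 2 <= eps) by nra.
  assert (pb : forall x z, 0 < x < 1 -> z = x \/ z = - x ->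
    eps * (al * lam) * (x ^ 2 * (1 - x ^ 2)) - c * eps ^ 3
    <= par a w al be ga de x (eps * sqrt (W z))).
  { intros x z hx hz.
    assert (hz' : -1 < z < 1) by (destruct hz; lra).
    assert (z2 : z ^ 2 = x ^ 2) by (destruct hz; subst; ring).
    assert (hWz : 0 < W z) by (apply hW; lra).
    pose proof (sqrt_lower w (W z) z hw ltac:(lra) (proj1 (B z ltac:(lra)))) as lo.
    fold lam in lo. rewrite z2 in lo.
    assert (hi : sqrt (W z) <= sA) by (apply sqrt_le_1_alt, B; lra).
    assert (q0 : 0 < sqrt (W z)) by now apply sqrt_lt_R0.
    set (y := eps * sqrt (W z)) in *.
    assert (hy : 0 < y) by now apply Rmult_lt_0_compat.
    pose proof (par_bound a w al be ga de x y hw ha hy) as pbd.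
    apply Rabs_le_between in pbd.
    assert (hX : 0 <= w * x ^ 2) by (pose proof (pow2_ge_0 x); mono).
    assert (hy2 : 0 < y ^ 2) by now apply pow_lt.
    assert (f5 : y ^ 5 / (y ^ 2 + w * x ^ 2) <= y ^ 3).
    { apply Rle_div_l; [lra|].
      assert (0 <= y ^ 3 * (w * x ^ 2)) by mono. 
      replace (y ^ 5) with (y ^ 3 * y ^ 2) by ring. lra. }
    assert (y3 : y ^ 3 <= eps ^ 3 * sA ^ 3).
    { rewrite <- Rpow_mult_distr. apply pow_incr. split; [lra|].
      apply Rmult_le_compat_l; lra. }
    assert (y3p : 0 < y ^ 3) by now apply pow_lt.
    assert (t1 : k * y ^ 3 <= c * eps ^ 3).
    { unfold c. rewrite Rmult_assoc. apply Rmult_le_compat_l; lra. }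
    assert (t2 : rem_cst a w ga de * (y ^ 5 / (y ^ 2 + w * x ^ 2)) <= rem_cst a w ga de * y ^ 3).
    { apply Rmult_le_compat_l; [now apply rem_cst_nonneg | exact f5]. }
    assert (t3 : - (Rabs be * y ^ 3) <= be * y ^ 3).
    { pose proof (Rle_abs (- be)). rewrite Rabs_Ropp in H. nra. }
    assert (t4 : eps * (al * lam) * (x ^ 2 * (1 - x ^ 2)) <= al * x ^ 2 * y).
    { replace (eps * (al * lam) * (x ^ 2 * (1 - x ^ 2)))
        with (al * x ^ 2 * (eps * (lam * (1 - x ^ 2)))) by ring.
      apply Rmult_le_compat_l; [pose proof (pow2_ge_0 x); mono|].
      apply Rmult_le_compat_l; lra. }
    unfold k in t1. lra. }
  pose proof (half_turn_compare a w e1 p1 r1 al be ga de eps W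
    (fun x => 4 * (eps * (al * lam)) * (x ^ 3 / 3 - x ^ 5 / 5) - 4 * c * eps ^ 3 * x)
    (fun x => 4 * (eps * (al * lam)) * (x ^ 2 * (1 - x ^ 2)) - 4 * c * eps ^ 3)
    (eps * P) hw ha he hW) as K.
  cbv beta in K. fold L in K.
  assert (D : forall x, is_derive
    (fun x => 4 * (eps * (al * lam)) * (x ^ 3 / 3 - x ^ 5 / 5) - 4 * c * eps ^ 3 * x) x
    (4 * (eps * (al * lam)) * (x ^ 2 * (1 - x ^ 2)) - 4 * c * eps ^ 3)).
  { intros x. auto_derive; [exact Logic.I|]. field. }
  assert (e3 : eps ^ 3 <= eps) by nra.
  assert (e3' : eps ^ 3 <= eps * eps) by nra.
  assert (e30 : 0 < eps ^ 3) by now apply pow_lt.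
  assert (M : 4 * (eps * (al * lam)) * (1 ^ 3 / 3 - 1 ^ 5 / 5) - 4 * c * eps ^ 3 * 1
    <= 2 * (eps ^ 2 * L) * (eps * P)).
  { apply K.
    - assert (eps ^ 2 * L <= eps * L) by (apply Rmult_le_compat_r; lra). lra.
    - intros x. eapply is_derive_continuity_pt, D.
    - field.
    - intros x hx.
      assert (x3 : 0 <= x ^ 3 <= 1) by (split; [apply pow_le; lra |
        rewrite <- (pow1 3); apply pow_incr; lra]).
      assert (x5 : 0 <= x ^ 5 <= 1) by (split; [apply pow_le; lra |
        rewrite <- (pow1 5); apply pow_incr; lra]).
      assert (0 <= eps * (al * lam)) by mono.
      assert (0 <= c * eps ^ 3 <= c * eps).
      { split; [mono | apply Rmult_le_compat_l; lra]. }
      assert (c * eps ^ 3 * x <= c * eps * 1) by (apply Rmult_le_compat; lra).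
      assert (0 <= c * eps ^ 3 * x) by mono.
      unfold P. apply Rabs_le. split; nra.
    - intros x _. apply D.
    - intros x hx. pose proof (pb x x hx (or_introl eq_refl)).
      pose proof (pb x (- x) hx (or_intror eq_refl)). lra. }
  assert (2 * (eps ^ 2 * L) * (eps * P) + 4 * c * eps ^ 3
          <= eps * (eps * (4 * c + 2 * L * P))).
  { replace (2 * (eps ^ 2 * L) * (eps * P) + 4 * c * eps ^ 3)
      with (eps ^ 3 * (4 * c + 2 * L * P)) by ring.
    rewrite <- Rmult_assoc. apply Rmult_le_compat_r; [|exact e3'].
    assert (0 <= L * P) by mono. lra. }
  assert (eps * (eps * (4 * c + 2 * L * P)) < eps * (8 / 15 * (al * lam))).
  { apply Rmult_lt_compat_l; lra. }
  lra.
Qed.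

(** The lower bound for [W] degenerates at the ends, but there the deficit [eps^2 x^4 / (4 w)] is
    absorbed by half of [w x^2]. *)
Lemma weight_lower w eps W x :
  0 < w -> 0 < eps < 1 -> eps * (/ (4 * w)) < w / 2 -> -1 <= x <= 1 ->
  (1 - x ^ 4) / (4 * w) <= W ->
  Rmin (/ (4 * w)) (w / 2) * (x ^ 2 + eps ^ 2) <= eps ^ 2 * W + w * x ^ 2.
Proof.
  intros hw he hs hx hW.
  set (i := / (4 * w)) in *. assert (hi : 0 < i) by (apply Rinv_0_lt_compat; lra).
  change ((1 - x ^ 4) / (4 * w)) with ((1 - x ^ 4) * i) in hW.
  assert (x2 : 0 <= x ^ 2 <= 1) by (split; [apply pow2_ge_0 | nra]).
  assert (x4 : x ^ 4 <= x ^ 2) by nra.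
  assert (e2 : 0 < eps ^ 2 <= eps) by (split; [apply pow_lt; lra | nra]).
  pose proof (Rmin_l i (w / 2)). pose proof (Rmin_r i (w / 2)).
  assert (eps ^ 2 * ((1 - x ^ 4) * i) <= eps ^ 2 * W) by (apply Rmult_le_compat_l; lra).
  assert (eps ^ 2 * i * x ^ 4 <= (w / 2) * x ^ 2).
  { apply Rmult_le_compat; try lra; [mono | replace (x ^ 4) with ((x ^ 2) ^ 2) by ring; mono |].
    assert (eps ^ 2 * i <= eps * i) by (apply Rmult_le_compat_r; lra). lra. }
  assert (Rmin i (w / 2) * x ^ 2 <= w / 2 * x ^ 2) by (apply Rmult_le_compat_r; lra).
  assert (Rmin i (w / 2) * eps ^ 2 <= i * eps ^ 2) by (apply Rmult_le_compat_r; lra).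
  lra.
Qed.

Lemma atan_abs_le x : Rabs (atan x) <= 2.
Proof.
  pose proof (atan_bound x). pose proof PI_4. apply Rabs_le; lra.
Qed.

(** The [be] term contributes order [eps^3], and near [x = 0] the remainder has the same pointwise
    size. Its weight [eps^5 / (x^2 + eps^2)] decides: the primitive [eps^4 atan (x / eps)] is one
    order smaller. *)
Lemma no_half_turn_order3 a w e1 p1 r1 be ga de :
  0 < w -> a ^ 2 < 4 * w -> 0 < be ->
  small (fun eps => forall W, ~ half_turn (slope a w e1 p1 r1 0 be ga de) eps W).
Proof.
  intros hw ha hbe.
  set (L := 2 * (Rabs e1 + lip_cst a w p1 r1)).
  assert (hL : 0 <= L).
  { pose proof (Rabs_pos e1). pose proof (lip_cst_nonneg a w p1 r1 hw ha). unfold L; lra. }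
  set (lam := sqrt (/ (4 * w))).
  assert (hlam : 0 < lam) by (apply sqrt_lt_R0, Rinv_0_lt_compat; lra).
  set (sA := sqrt (/ w)).
  assert (hsA : 0 < sA) by (apply sqrt_lt_R0, Rinv_0_lt_compat; lra).
  set (k1 := Rmin (/ (4 * w)) (w / 2)).
  assert (hk1 : 0 < k1) by (apply Rmin_pos; [apply Rinv_0_lt_compat; lra | lra]).
  set (k := rem_cst a w ga de).
  assert (hk : 0 <= k) by now apply rem_cst_nonneg.
  set (c := k * (sA ^ 5 / k1)).
  assert (hc : 0 <= c).
  { apply Rmult_le_pos; [exact hk|]. apply Rdiv_le_0_compat; [mono | exact hk1]. }
  set (b := be * lam ^ 3).
  assert (hb0 : 0 < b) by (apply Rmult_lt_0_compat; [lra | now apply pow_lt]).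
  set (P := 16 * b + 8 * c).
  assert (hP : 0 <= P) by (unfold P; lra).
  eapply small_imp.
  { apply small_and; [exact (half_turn_bounds a w e1 p1 r1 0 be ga de hw ha)|].
    apply small_and; [apply (small_mult 1 1); lra|].
    apply small_and; [apply (small_mult (1 / 2) L); lra|].
    apply small_and; [apply (small_mult (w / 2) (/ (4 * w))); lra|].
    (* [64 / 35] is 4 times the integral of [(1 - x^2)^3] over [[0, 1]]; [8 c] comes from bounding
       [atan] by 2. *)
    apply (small_mult (64 / 35 * b) (8 * c + 2 * L * P)); lra. }
  cbv beta. intros eps he [hb [s1 [s2 [s4 s3]]]] W hW.
  assert (B : forall x, -1 <= x <= 1 -> (1 - x ^ 4) / (4 * w) <= W x <= / w) by now apply hb.
  clear hb.
  assert (e2 : 0 < eps ^ 2 <= eps) by (split; [now apply pow_lt | nra]).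
  assert (e3p : 0 < eps ^ 3) by now apply pow_lt.
  assert (e4 : eps ^ 4 = eps * eps ^ 3) by ring.
  assert (e5 : eps ^ 5 = eps ^ 2 * eps ^ 3) by ring.
  assert (pb : forall x z, 0 < x < 1 -> z = x \/ z = - x ->
    b * eps ^ 3 * (1 - x ^ 2) ^ 3 - c * (eps ^ 5 / (x ^ 2 + eps ^ 2))
    <= par a w 0 be ga de x (eps * sqrt (W z))).
  { intros x z hx hz.
    assert (hz' : -1 < z < 1) by (destruct hz; lra).
    assert (z2 : z ^ 2 = x ^ 2) by (destruct hz; subst; ring).
    assert (hWz : 0 < W z) by (apply hW; lra).
    pose proof (B z ltac:(lra)) as [Bl Bu].
    pose proof (sqrt_lower w (W z) z hw ltac:(lra) Bl) as lo.
    fold lam in lo. rewrite z2 in lo.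
    pose proof (weight_lower w eps (W z) z hw ltac:(lra) s4 ltac:(lra) Bl) as wl.
    fold k1 in wl. rewrite z2 in wl.
    assert (hi : sqrt (W z) <= sA) by (apply sqrt_le_1_alt; lra).
    assert (q0 : 0 < sqrt (W z)) by now apply sqrt_lt_R0.
    assert (yy : (eps * sqrt (W z)) ^ 2 = eps ^ 2 * W z) by (rewrite Rpow_mult_distr, pow2_sqrt; lra).
    set (y := eps * sqrt (W z)) in *.
    assert (hy : 0 < y) by now apply Rmult_lt_0_compat.
    pose proof (par_bound a w 0 be ga de x y hw ha hy) as pbd.
    apply Rabs_le_between in pbd. fold k in pbd. rewrite yy in pbd.
    assert (x2 : 0 <= x ^ 2 <= 1) by (split; [apply pow2_ge_0 | nra]).
    assert (f5 : y ^ 5 / (eps ^ 2 * W z + w * x ^ 2) <= sA ^ 5 / k1 * (eps ^ 5 / (x ^ 2 + eps ^ 2))).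
    { replace (sA ^ 5 / k1 * (eps ^ 5 / (x ^ 2 + eps ^ 2)))
        with ((eps * sA) ^ 5 / (k1 * (x ^ 2 + eps ^ 2))) by (rewrite Rpow_mult_distr; field; lra).
      apply Rmult_le_compat.
      - apply pow_le; lra.
      - left. apply Rinv_0_lt_compat. eapply Rlt_le_trans; [|exact wl].
        apply Rmult_lt_0_compat; lra.
      - apply pow_incr. split; [lra|]. apply Rmult_le_compat_l; lra.
      - apply Rinv_le_contravar; [apply Rmult_lt_0_compat; lra | exact wl]. }
    apply (Rmult_le_compat_l k) in f5; [|exact hk].
    assert (y3 : eps ^ 3 * (lam * (1 - x ^ 2)) ^ 3 <= y ^ 3).
    { unfold y. rewrite (Rpow_mult_distr eps). apply Rmult_le_compat_l; [lra|].
      apply pow_incr. split; [mono | exact lo]. }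
    apply (Rmult_le_compat_l be) in y3; [|lra].
    replace (be * (eps ^ 3 * (lam * (1 - x ^ 2)) ^ 3)) with (b * eps ^ 3 * (1 - x ^ 2) ^ 3)
      in y3 by (unfold b; ring).
    unfold c. lra. }
  set (phi := fun x => 4 * (b * eps ^ 3) * (x - x ^ 3 + 3 * x ^ 5 / 5 - x ^ 7 / 7)
                       - 4 * c * (eps ^ 4 * atan (x / eps))).
  pose proof (half_turn_compare a w e1 p1 r1 0 be ga de eps W phi
    (fun x => 4 * (b * eps ^ 3) * (1 - x ^ 2) ^ 3 - 4 * c * (eps ^ 5 / (x ^ 2 + eps ^ 2)))
    (eps ^ 3 * P) hw ha he hW) as K.
  cbv beta in K. fold L in K.
  assert (D : forall x, is_derive phi x
    (4 * (b * eps ^ 3) * (1 - x ^ 2) ^ 3 - 4 * c * (eps ^ 5 / (x ^ 2 + eps ^ 2)))).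
  { intros x. assert (0 < x ^ 2 + eps ^ 2) by (pose proof (pow2_ge_0 x); lra).
    unfold phi. auto_derive; [exact Logic.I|]. unfold Rsqr. field. 
    repeat split; nra. }
  assert (ceps : 0 <= c * eps ^ 4 <= c * eps ^ 3).
  { split; [mono|]. apply Rmult_le_compat_l; [lra|]. rewrite e4. nra. }
  assert (beps : 0 < b * eps ^ 3) by now apply Rmult_lt_0_compat.
  assert (M : phi 1 <= 2 * (eps ^ 2 * L) * (eps ^ 3 * P)).
  { apply K.
    - assert (eps ^ 2 * L <= eps * L) by (apply Rmult_le_compat_r; lra). lra.
    - intros x. eapply is_derive_continuity_pt, D.
    - unfold phi. replace (0 / eps) with 0 by (field; lra). rewrite atan_0. field.
    - intros x hx.
      assert (pw : forall n, 0 <= x ^ n <= 1).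
      { intros n. split; [apply pow_le; lra|]. rewrite <- (pow1 n). apply pow_incr; lra. }
      pose proof (pw 3%nat). pose proof (pw 5%nat). pose proof (pw 7%nat).
      unfold phi. unfold Rminus at 1. eapply Rle_trans; [apply Rabs_triang|].
      rewrite Rabs_Ropp, Rabs_mult, (Rabs_right (4 * (b * eps ^ 3))) by lra.
      replace (4 * c * (eps ^ 4 * atan (x / eps))) with (4 * (c * eps ^ 4) * atan (x / eps)) by ring.
      rewrite (Rabs_mult (4 * (c * eps ^ 4))), (Rabs_right (4 * (c * eps ^ 4))) by lra.
      assert (4 * (b * eps ^ 3) * Rabs (x - x ^ 3 + 3 * x ^ 5 / 5 - x ^ 7 / 7)
              <= 4 * (b * eps ^ 3) * 4).
      { apply Rmult_le_compat_l; [lra|]. apply Rabs_le; lra. }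
      assert (4 * (c * eps ^ 4) * Rabs (atan (x / eps)) <= 4 * (c * eps ^ 3) * 2).
      { apply Rmult_le_compat; try lra; [apply Rabs_pos | apply atan_abs_le]. }
      unfold P. lra.
    - intros x _. apply D.
    - intros x hx. pose proof (pb x x hx (or_introl eq_refl)).
      pose proof (pb x (- x) hx (or_intror eq_refl)). lra. }
  unfold phi in M.
  assert (at1 : c * eps ^ 4 * atan (1 / eps) <= c * eps ^ 4 * 2).
  { apply Rmult_le_compat_l; [lra|]. pose proof (atan_abs_le (1 / eps)).
    apply Rabs_le_between in H. lra. }
  assert (2 * (eps ^ 2 * L) * (eps ^ 3 * P) + 8 * (c * eps ^ 4)
          <= eps ^ 3 * (eps * (8 * c + 2 * L * P))).
  { rewrite e4.
    replace (2 * (eps ^ 2 * L) * (eps ^ 3 * P) + 8 * (c * (eps * eps ^ 3)))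
      with (eps ^ 3 * (eps * (8 * c) + eps ^ 2 * (2 * L * P))) by ring.
    apply Rmult_le_compat_l; [lra|].
    assert (0 <= 2 * L * P) by mono.
    assert (eps ^ 2 * (2 * L * P) <= eps * (2 * L * P)) by (apply Rmult_le_compat_r; lra).
    lra. }
  assert (eps ^ 3 * (eps * (8 * c + 2 * L * P)) < eps ^ 3 * (64 / 35 * b)).
  { apply Rmult_lt_compat_l; lra. }
  lra.
Qed.

(** * The profile of the remainder on the scale [z = x / y] *)

Lemma kernel_den_pos a w z : 0 < w -> a ^ 2 < 4 * w -> 0 < den a w (z ^ 2) 1.
Proof.
  intros hw ha. apply den_pos; auto.
  assert (0 <= w * z ^ 2) by (pose proof (pow2_ge_0 z); mono). lra.
Qed.

(** Partial fractions: the denominator is [(1 + a z + w z^2) (1 - a z + w z^2)], and the integrand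
    is half the sum of the reciprocals of the factors. Being positive, it keeps the primitive above
    its value at [1]. *)
Lemma even_kernel_primitive a w :
  0 < w -> a ^ 2 < 4 * w ->
  exists K, K 0 = 0 /\
    (forall z, is_derive K z ((1 + w * z ^ 2) / den a w (z ^ 2) 1)) /\
    (forall z, Rabs (K z) <= 4 / sqrt (4 * w - a ^ 2)) /\
    exists k, 0 < k /\ forall z, 1 <= z -> k <= K z.
Proof.
  intros hw ha. set (s := sqrt (4 * w - a ^ 2)).
  assert (hs : 0 < s) by (apply sqrt_lt_R0; lra).
  assert (ss : s ^ 2 = 4 * w - a ^ 2) by (unfold s; rewrite pow2_sqrt; lra).
  set (K := fun z => (atan ((2 * w * z + a) / s) + atan ((2 * w * z - a) / s)) / s).
  assert (K0 : K 0 = 0).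
  { unfold K. replace ((2 * w * 0 - a) / s) with (- ((2 * w * 0 + a) / s)) by (field; lra).
    rewrite atan_opp. field; lra. }
  assert (D : forall z, is_derive K z ((1 + w * z ^ 2) / den a w (z ^ 2) 1)).
  { intros z. pose proof (kernel_den_pos a w z hw ha) as hd.
    unfold K. auto_derive; [exact Logic.I|]. unfold Rsqr. revert hd. unfold den.
    (* Eliminating [w] in favour of [s] turns both factors of the denominator into completed
       squares, a form that [field] can verify. *)
    replace w with ((s ^ 2 + a ^ 2) / 4) by lra. intros hd.
    set (v := (s ^ 2 + a ^ 2) / 4) in *.
    assert (s2 : 0 < s ^ 2) by now apply pow_lt.
    assert (0 < s ^ 2 + (2 * v * z + a) ^ 2) by (pose proof (pow2_ge_0 (2 * v * z + a)); lra).
    assert (0 < s ^ 2 + (2 * v * z - a) ^ 2) by (pose proof (pow2_ge_0 (2 * v * z - a)); lra).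
    assert (F : (1 + v * z ^ 2) ^ 2 - a ^ 2 * z ^ 2 * 1 =
      (s ^ 2 + (2 * v * z + a) ^ 2) * (s ^ 2 + (2 * v * z - a) ^ 2) / (16 * v ^ 2)).
    { unfold v. field. nra. }
    assert (hv : v <> 0) by (unfold v; pose proof (pow2_ge_0 a); lra).
    rewrite F.
    replace (1 + v * z ^ 2) with
      ((s ^ 2 + (2 * v * z + a) ^ 2 + (s ^ 2 + (2 * v * z - a) ^ 2)) / (8 * v)).
    2: { unfold v. field. pose proof (pow2_ge_0 a). lra. }
    field. repeat split; try lra; nra. }
  exists K. split; [exact K0|]. split; [exact D|]. split.
  - intros z. unfold K, Rdiv at 1. rewrite Rabs_mult, Rabs_inv, (Rabs_right s) by lra.
    apply Rmult_le_compat_r; [left; now apply Rinv_0_lt_compat|].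
    eapply Rle_trans; [apply Rabs_triang|].
    pose proof (atan_abs_le ((2 * w * z + a) / s)). pose proof (atan_abs_le ((2 * w * z - a) / s)). lra.
  - assert (Dpos : forall z, 0 < (1 + w * z ^ 2) / den a w (z ^ 2) 1).
    { intros z. apply Rdiv_lt_0_compat; [|now apply kernel_den_pos].
      assert (0 <= w * z ^ 2) by (pose proof (pow2_ge_0 z); mono). lra. }
    assert (cK : forall z, continuity_pt K z) by (intros z; eapply is_derive_continuity_pt, D).
    exists (K 1). split.
    + destruct (mvt_open K _ 0 1 Rlt_0_1 (fun z _ => D z) (fun z _ => cK z)) as [z [_ hz]].
      specialize (Dpos z). rewrite K0 in hz. lra.
    + intros z hz. assert (0 * (z - 1) <= K z - K 1); [|lra].
      eapply increment_ge; [exact hz | | intros; apply cK].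
      intros x _. split; [apply D | left; apply Dpos].
Qed.

(** The form [(1 - w z^2) / den dz] is invariant under [z -> 1 / (w z)], which exchanges 0 and
    infinity: its integral over the half line vanishes. *)
Lemma odd_kernel_primitive a w :
  0 < w -> a ^ 2 < 4 * w ->
  exists K, K 0 = 0 /\
    (forall z, is_derive K z ((1 - w * z ^ 2) / den a w (z ^ 2) 1)) /\
    (forall z, 0 <= z -> Rabs (K z) <= z / kap a w) /\
    (forall z, 0 < z -> Rabs (K z) <= / (w * z) / kap a w).
Proof.
  intros hw ha. pose proof (kap_pos a w hw ha) as hk.
  set (k := fun z => (1 - w * z ^ 2) / den a w (z ^ 2) 1).
  assert (ck : forall z, continuous k z).
  { intros z. apply (ex_derive_continuous (V := R_NormedModule)).
    pose proof (kernel_den_pos a w z hw ha). unfold k, den in *. auto_derive. lra. }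
  set (K := fun z => RInt k 0 z).
  assert (D : forall z, is_derive K z (k z)).
  { intros z. apply (is_derive_RInt (V := R_CompleteNormedModule) k K 0 z); [|apply ck].
    apply filter_forall. intros y. apply (RInt_correct (V := R_CompleteNormedModule)).
    apply (ex_RInt_continuous (V := R_CompleteNormedModule)). intros x _. apply ck. }
  assert (cK : forall z, continuity_pt K z) by (intros z; eapply is_derive_continuity_pt, D).
  assert (K0 : K 0 = 0) by apply (RInt_point (V := R_CompleteNormedModule)).
  assert (kb : forall z, Rabs (k z) <= / kap a w).
  { intros z. unfold k. apply Rabs_div_le; [now apply kernel_den_pos|].
    pose proof (den_ge a w (z ^ 2) 1 hw) as h.
    assert (t : 0 <= w * z ^ 2) by (pose proof (pow2_ge_0 z); mono).
    apply Rle_trans with (/ kap a w * (kap a w * (1 + w * z ^ 2) ^ 2)).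
    - rewrite <- Rmult_assoc, Rinv_l, Rmult_1_l by lra. apply Rabs_le. nra.
    - apply Rmult_le_compat_l; [left; now apply Rinv_0_lt_compat | exact h]. }
  assert (lin : forall z, 0 <= z -> Rabs (K z) <= z / kap a w).
  { intros z hz. replace (K z) with (K z - K 0) by lra.
    replace (z / kap a w) with (/ kap a w * (z - 0)) by (field; lra).
    apply increment_abs_le with (df := k); auto. }
  exists K. split; [exact K0|]. split; [exact D|]. split; [exact lin|].
  intros z hz. replace (K z) with (K (/ (w * z))).
  { apply lin. left. apply Rinv_0_lt_compat. now apply Rmult_lt_0_compat. }
  set (H := fun z => K (/ (w * z)) - K z).
  assert (DH : forall z, 0 < z -> is_derive H z 0).
  { intros x hx. unfold H.
    assert (hwx : 0 < w * x) by now apply Rmult_lt_0_compat.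
    apply is_derive_eq with (minus (scal (- w / (w * x) ^ 2) (k (/ (w * x)))) (k x)).
    - apply (is_derive_minus (K := R_AbsRing) (V := R_NormedModule)); [|apply D].
      apply (is_derive_comp K (fun x => / (w * x))); [apply D|].
      auto_derive; [lra|]. field. lra.
    - unfold minus, plus, opp, scal; simpl. unfold mult; simpl.
      pose proof (kernel_den_pos a w x hw ha).
      pose proof (kernel_den_pos a w (/ (w * x)) hw ha). revert H0 H1. unfold k, den.
      replace ((/ (w * x)) ^ 2) with (/ (w * x) ^ 2) by (field; lra).
      replace ((1 + w * / (w * x) ^ 2) ^ 2 - a ^ 2 * / (w * x) ^ 2 * 1)
        with (((1 + w * x ^ 2) ^ 2 - a ^ 2 * x ^ 2 * 1) / (w * x ^ 2) ^ 2) by (field; lra).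
      intros h1 _. field. lra. }
  (* The fixed point of [z -> / (w z)]: the constant [H] vanishes there, hence on the whole half
     line. *)
  set (z0 := / sqrt w). assert (sw : 0 < sqrt w) by now apply sqrt_lt_R0.
  assert (hz0 : 0 < z0) by now apply Rinv_0_lt_compat.
  assert (H0 : H z0 = 0).
  { unfold H. replace (/ (w * z0)) with z0; [lra|]. unfold z0.
    rewrite <- (sqrt_sqrt w) at 2 by lra. field. lra. }
  enough (E : H z = 0) by (unfold H in E; lra).
  assert (cst : forall x y, 0 < x -> x <= y -> H y - H x = 0).
  { intros x y hx hxy. apply Rabs_eq_0. apply Rle_antisym; [|apply Rabs_pos].
    replace 0 with (0 * (y - x)) by ring.
    apply increment_abs_le with (df := fun _ => 0); auto.
    - intros t ht. split; [apply DH; lra|]. rewrite Rabs_R0. apply Rle_refl.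
    - intros t ht. eapply is_derive_continuity_pt, DH. lra. }
  destruct (Rle_lt_dec z z0) as [h | h].
  - specialize (cst z z0 hz h). lra.
  - specialize (cst z0 z hz0 ltac:(lra)). lra.
Qed.

(** The numerator is split as [th (1 + w z^2) + vt (1 - w z^2)]. The second primitive tends to [0]
    at infinity, so the sign of the limit is that of [th = (ga + w de) / (2 w)]; this is where the
    combination [ga + w de] originates. *)
Lemma kernel_primitive a w ga de :
  0 < w -> a ^ 2 < 4 * w -> 0 < ga + w * de ->
  exists K, K 0 = 0 /\
    (forall z, is_derive K z ((ga * z ^ 2 + de) / den a w (z ^ 2) 1)) /\
    (exists B, forall z, 0 <= z -> Rabs (K z) <= B) /\
    (exists k, 0 < k /\ small (fun t => k <= K (/ t))).
Proof.
  intros hw ha hg.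
  destruct (even_kernel_primitive a w hw ha) as [K1 [K10 [D1 [B1 [k1 [hk1 L1]]]]]].
  destruct (odd_kernel_primitive a w hw ha) as [K2 [K20 [D2 [B2 B2']]]].
  pose proof (kap_pos a w hw ha) as hk.
  set (th := (ga / w + de) / 2). set (vt := (de - ga / w) / 2).
  assert (hth : 0 < th).
  { unfold th. replace (ga / w + de) with ((ga + w * de) / w) by (field; lra).
    assert (0 < (ga + w * de) / w) by (apply Rdiv_lt_0_compat; lra). lra. }
  exists (fun z => th * K1 z + vt * K2 z). split; [|split; [|split]].
  - rewrite K10, K20; ring.
  - intros z. pose proof (kernel_den_pos a w z hw ha).
    eapply is_derive_eq.
    + apply (is_derive_plus (K := R_AbsRing) (V := R_NormedModule)
        (fun z => th * K1 z) (fun z => vt * K2 z)); apply is_derive_scal; auto.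
    + set (q := den a w (z ^ 2) 1) in *. unfold plus; simpl. unfold th, vt. field. lra.
  - exists (th * (4 / sqrt (4 * w - a ^ 2)) + Rabs vt * (/ kap a w + / w / kap a w)).
    intros z hz. eapply Rle_trans; [apply Rabs_triang|].
    rewrite !Rabs_mult, (Rabs_right th) by lra.
    apply Rplus_le_compat; [apply Rmult_le_compat_l; [lra | apply B1]|].
    apply Rmult_le_compat_l; [apply Rabs_pos|].
    assert (ik : 0 < / kap a w) by now apply Rinv_0_lt_compat.
    assert (iw : 0 < / w) by now apply Rinv_0_lt_compat.
    assert (0 < / w / kap a w) by (apply Rdiv_lt_0_compat; lra).
    destruct (Rle_lt_dec z 1) as [h | h].
    + eapply Rle_trans; [apply B2, hz|].
      assert (z / kap a w <= 1 * / kap a w) by (apply Rmult_le_compat_r; lra). lra.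
    + eapply Rle_trans; [apply B2'; lra|].
      assert (/ (w * z) / kap a w <= / w / kap a w); [|lra].
      apply Rmult_le_compat_r; [lra|]. apply Rinv_le_contravar; [lra|]. nra.
  - exists (th * k1 / 2). assert (hp : 0 < th * k1) by now apply Rmult_lt_0_compat.
    split; [lra|].
    eapply small_imp.
    { apply small_and; [apply (small_mult 1 1); lra|].
      apply (small_mult (th * k1 / 2) (Rabs vt * (/ w / kap a w))); lra. }
    cbv beta. intros t ht [t1 t2].
    assert (it : 1 <= / t) by (rewrite <- Rinv_1; apply Rinv_le_contravar; lra).
    pose proof (B2' (/ t) ltac:(lra)) as b.
    replace (/ (w * / t) / kap a w) with (t * (/ w / kap a w)) in b by (field; lra).
    assert (th * k1 <= th * K1 (/ t)) by (apply Rmult_le_compat_l; [lra | now apply L1]).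
    assert (Rabs (vt * K2 (/ t)) <= Rabs vt * (t * (/ w / kap a w))).
    { rewrite Rabs_mult. apply Rmult_le_compat_l; [apply Rabs_pos | exact b]. }
    apply Rabs_le_between in H0. lra.
Qed.

(** On [[- x, x]] the slope is [O((x + eps)^3)], so [W] moves away from [W 0] by [O((x + eps)^3 x)].
    The bound is stated with [x^2 + eps^2] because this is the weight from [weight_lower], against
    which it will cancel. *)
Lemma half_turn_variation a w e1 p1 r1 al be ga de eps W :
  0 < w -> a ^ 2 < 4 * w -> 0 < eps < 1 -> al = 0 ->
  half_turn (slope a w e1 p1 r1 al be ga de) eps W ->
  (forall x, -1 <= x <= 1 -> W x <= / w) ->
  forall x z, 0 < x < 1 -> z = x \/ z = - x ->
  Rabs (W z - W 0)
  <= 16 * (/ w + (Rabs e1 + rem_cst a w p1 r1) * / w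
           + (Rabs be + rem_cst a w ga de) * sqrt (/ w) ^ 3) * (x ^ 2 + eps ^ 2).
Proof.
  intros hw ha he hal [hc [h1 [hm1 [hpos hd]]]] hA x z hx hz.
  set (A := / w) in *. assert (hA0 : 0 < A) by now apply Rinv_0_lt_compat.
  set (sA := sqrt A). assert (hsA : 0 < sA) by now apply sqrt_lt_R0.
  set (k1 := Rabs e1 + rem_cst a w p1 r1). set (k2 := Rabs be + rem_cst a w ga de).
  assert (hk1 : 0 <= k1).
  { apply Rplus_le_le_0_compat; [apply Rabs_pos | now apply rem_cst_nonneg]. }
  assert (hk2 : 0 <= k2).
  { apply Rplus_le_le_0_compat; [apply Rabs_pos | now apply rem_cst_nonneg]. }
  set (C := A + k1 * A + k2 * sA ^ 3). assert (hC : 0 <= C) by (unfold C; mono).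
  set (F := slope a w e1 p1 r1 al be ga de) in *.
  assert (bd : forall t, - x <= t <= x -> Rabs (2 * F t (eps * sqrt (W t))) <= 2 * C * (x + eps) ^ 3).
  { intros t ht. rewrite Rabs_mult, (Rabs_right 2), Rmult_assoc by lra.
    apply Rmult_le_compat_l; [lra|].
    assert (hW : 0 < W t) by (apply hpos; lra).
    assert (q0 : 0 < sqrt (W t)) by now apply sqrt_lt_R0.
    assert (qA : sqrt (W t) <= sA) by (apply sqrt_le_1_alt, hA; lra).
    set (y := eps * sqrt (W t)).
    assert (hy : 0 < y) by (apply Rmult_lt_0_compat; lra).
    assert (hye : y <= eps * sA) by (apply Rmult_le_compat_l; lra).
    pose proof (slope_bound a w e1 p1 r1 al be ga de t y hw ha hy) as S.
    fold F k1 k2 in S. rewrite hal, Rabs_R0, Rmult_0_l, Rplus_0_l in S.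
    assert (tx : Rabs t <= x) by (apply Rabs_le; lra).
    pose proof (Rabs_pos t) as t0.
    assert (t3 : Rabs (t ^ 3 / w) <= A * x ^ 3).
    { unfold Rdiv. rewrite Rabs_mult, (Rabs_right (/ w)), Rmult_comm by (left; exact hA0).
      apply Rmult_le_compat_l; [lra|]. rewrite <- RPow_abs. now apply pow_incr. }
    assert (y2 : y ^ 2 <= eps ^ 2 * A).
    { unfold y. rewrite Rpow_mult_distr, pow2_sqrt by lra.
      apply Rmult_le_compat_l; [apply pow2_ge_0 | apply hA; lra]. }
    assert (y3 : y ^ 3 <= eps ^ 3 * sA ^ 3).
    { rewrite <- Rpow_mult_distr. apply pow_incr. lra. }
    assert (y20 : 0 <= y ^ 2) by apply pow2_ge_0.
    assert (m1 : Rabs t * y ^ 2 <= x * (eps ^ 2 * A)) by (apply Rmult_le_compat; lra).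
    apply (Rmult_le_compat_l k1) in m1; [|lra].
    apply (Rmult_le_compat_l k2) in y3; [|lra].
    assert (T : Rabs (F t y) <= A * x ^ 3 + k1 * (x * (eps ^ 2 * A)) + k2 * (eps ^ 3 * sA ^ 3)).
    { replace (F t y) with ((F t y + t ^ 3 / w) + - (t ^ 3 / w)) by ring.
      eapply Rle_trans; [apply Rabs_triang|]. rewrite Rabs_Ropp.
      replace (y * (k2 * y ^ 2)) with (k2 * y ^ 3) in S by ring. lra. }
    eapply Rle_trans; [exact T|]. unfold C.
    assert (x3 : x ^ 3 <= (x + eps) ^ 3) by (apply pow_incr; lra).
    assert (e3 : eps ^ 3 <= (x + eps) ^ 3) by (apply pow_incr; lra).
    assert (xe : x * eps ^ 2 <= (x + eps) ^ 3).
    { replace ((x + eps) ^ 3) with ((x + eps) * (x + eps) ^ 2) by ring.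
      apply Rmult_le_compat; try lra; [apply pow2_ge_0 | apply pow_incr; lra]. }
    rewrite !Rmult_plus_distr_r. apply Rplus_le_compat; [apply Rplus_le_compat|].
    - apply Rmult_le_compat_l; lra.
    - replace (k1 * (x * (eps ^ 2 * A))) with (k1 * A * (x * eps ^ 2)) by ring.
      apply Rmult_le_compat_l; [mono | exact xe].
    - replace (k2 * (eps ^ 3 * sA ^ 3)) with (k2 * sA ^ 3 * eps ^ 3) by ring.
      apply Rmult_le_compat_l; [mono | exact e3]. }
  assert (V : Rabs (W z - W 0) <= 2 * C * (x + eps) ^ 3 * x).
  { destruct hz as [-> | ->].
    - replace x with (x - 0) at 3 by ring.
      apply increment_abs_le with (df := fun t => 2 * F t (eps * sqrt (W t))).
      + lra.
      + intros t ht. split; [apply hd | apply bd]; lra.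
      + intros t _. apply hc.
    - rewrite Rabs_minus_sym. replace x with (0 - - x) at 3 by ring.
      apply increment_abs_le with (df := fun t => 2 * F t (eps * sqrt (W t))).
      + lra.
      + intros t ht. split; [apply hd | apply bd]; lra.
      + intros t _. apply hc. }
  eapply Rle_trans; [exact V|].
  (* The factor 16 comes from [(x + eps)^2 <= 4], as both are less than 1, and
     [(x + eps) x <= 2 (x^2 + eps^2)]. *)
  replace (2 * C * (x + eps) ^ 3 * x) with (2 * C * ((x + eps) ^ 2 * ((x + eps) * x))) by ring.
  replace (16 * C * (x ^ 2 + eps ^ 2)) with (2 * C * (4 * (2 * (x ^ 2 + eps ^ 2)))) by ring.
  apply Rmult_le_compat_l; [lra|].
  apply Rmult_le_compat; [apply pow2_ge_0 | nra | nra | nra].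
Qed.

Lemma sqrt_diff_le u v l :
  0 <= u -> 0 <= v -> 0 < l -> l <= sqrt v -> Rabs (sqrt u - sqrt v) <= Rabs (u - v) / l.
Proof.
  intros hu hv hl h. pose proof (sqrt_pos u).
  apply Rle_div_r; [lra|].
  replace (u - v) with ((sqrt u - sqrt v) * (sqrt u + sqrt v)).
  - rewrite Rabs_mult. apply Rmult_le_compat_l; [apply Rabs_pos|].
    rewrite Rabs_right; lra.
  - rewrite <- (sqrt_sqrt u hu) at 3. rewrite <- (sqrt_sqrt v hv) at 3. ring.
Qed.

(** The remainder is now the leading term and changes sign in general, so it has to be integrated,
    not bounded. With [W] frozen at [W 0], the substitution [x = y0 z] turns its integral into
    [y0^4 K (1 / y0)], of exact order [eps^4]. Freezing costs only [O(eps^5)], uniformly in [x]. *)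
Lemma no_half_turn_order4 a w e1 p1 r1 ga de :
  0 < w -> a ^ 2 < 4 * w -> 0 < ga + w * de ->
  small (fun eps => forall W, ~ half_turn (slope a w e1 p1 r1 0 0 ga de) eps W).
Proof.
  intros hw ha hg.
  destruct (kernel_primitive a w ga de hw ha hg)
    as [K [K0 [DK [[B hB] [kp [hkp [t0 [ht0 hK]]]]]]]].
  set (L := 2 * (Rabs e1 + lip_cst a w p1 r1)).
  assert (hL : 0 <= L).
  { pose proof (Rabs_pos e1). pose proof (lip_cst_nonneg a w p1 r1 hw ha). unfold L; lra. }
  set (lam := sqrt (/ (4 * w))).
  assert (hlam : 0 < lam) by (apply sqrt_lt_R0, Rinv_0_lt_compat; lra).
  set (A := / w). assert (hA : 0 < A) by now apply Rinv_0_lt_compat.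
  set (sA := sqrt A).
  assert (hsA : 0 < sA) by now apply sqrt_lt_R0.
  assert (sA2 : sA ^ 2 = A) by (apply pow2_sqrt; lra).
  set (k1 := Rmin (/ (4 * w)) (w / 2)).
  assert (hk1 : 0 < k1) by (apply Rmin_pos; [apply Rinv_0_lt_compat; lra | lra]).
  set (k := rem_cst a w ga de).
  assert (hk : 0 <= k) by now apply rem_cst_nonneg.
  set (Lg := lip_cst a w ga de).
  assert (hLg : 0 <= Lg) by now apply lip_cst_nonneg.
  set (G := 16 * (A + (Rabs e1 + rem_cst a w p1 r1) * A + (Rabs 0 + k) * sA ^ 3)).
  assert (hG : 0 <= G).
  { pose proof (rem_cst_nonneg a w p1 r1 hw ha). pose proof (Rabs_pos e1).
    unfold G. rewrite Rabs_R0. mono. }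
  (* The first summand pays for replacing [y] by [y0] in front of the remainder, the second for
     replacing [y^2] by [y0^2] inside it. *)
  set (c := G * k * A ^ 2 / (lam * k1) + sA * (Lg * G * A / k1)).
  assert (hc : 0 <= c).
  { unfold c. apply Rplus_le_le_0_compat.
    - apply Rdiv_le_0_compat; [mono | now apply Rmult_lt_0_compat].
    - apply Rmult_le_pos; [lra|]. apply Rdiv_le_0_compat; [mono | lra]. }
  assert (hB0 : 0 <= B) by (eapply Rle_trans; [apply Rabs_pos | apply (hB 0); lra]).
  set (P := 4 * A ^ 2 * B + 4 * c).
  assert (hP : 0 <= P) by (unfold P; mono).
  set (l4 := 4 * lam ^ 4 * kp).
  assert (hl4 : 0 < l4) by (pose proof (pow_lt lam 4 hlam); unfold l4; repeat apply Rmult_lt_0_compat; lra).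
  eapply small_imp.
  { apply small_and; [exact (half_turn_bounds a w e1 p1 r1 0 0 ga de hw ha)|].
    apply small_and; [apply (small_mult 1 1); lra|].
    apply small_and; [apply (small_mult (1 / 2) L); lra|].
    apply small_and; [apply (small_mult (w / 2) (/ (4 * w))); lra|].
    apply small_and; [apply (small_mult t0 sA); lra|].
    apply (small_mult l4 (4 * c + 2 * L * P)); lra. }
  cbv beta. intros eps he [hb [s1 [s2 [s4 [s5 s3]]]]] W hW.
  assert (Bd : forall x, -1 <= x <= 1 -> (1 - x ^ 4) / (4 * w) <= W x <= / w) by now apply hb.
  clear hb.
  assert (e2 : 0 < eps ^ 2 <= eps) by (split; [now apply pow_lt | nra]).
  assert (e4 : 0 < eps ^ 4) by now apply pow_lt.
  assert (e5 : eps ^ 5 = eps * eps ^ 4) by ring.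
  pose proof (half_turn_variation a w e1 p1 r1 0 0 ga de eps W hw ha ltac:(lra)
    eq_refl hW (fun x hx => proj2 (Bd x hx))) as var.
  fold A in var. fold sA k in var. fold G in var.
  assert (W0 : 0 < W 0) by (apply hW; lra).
  set (y0 := eps * sqrt (W 0)).
  assert (y0l : lam <= sqrt (W 0)).
  { pose proof (sqrt_lower w (W 0) 0 hw ltac:(lra) (proj1 (Bd 0 ltac:(lra)))) as h.
    fold lam in h. lra. }
  assert (y0u : sqrt (W 0) <= sA) by (apply sqrt_le_1_alt, Bd; lra).
  assert (hy0 : 0 < y0) by (apply Rmult_lt_0_compat; lra).
  assert (y0e : eps * lam <= y0 <= eps * sA) by (split; apply Rmult_le_compat_l; lra).
  assert (yy0 : y0 ^ 2 = eps ^ 2 * W 0) by (unfold y0; rewrite Rpow_mult_distr, pow2_sqrt; lra).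
  assert (y04 : eps ^ 4 * lam ^ 4 <= y0 ^ 4 <= eps ^ 4 * A ^ 2).
  { rewrite <- sA2, <- pow_mult, <- !Rpow_mult_distr. simpl Nat.mul.
    split; (apply pow_incr; split; [|lra]); [mono | lra]. }
  assert (pb : forall x z, 0 < x < 1 -> z = x \/ z = - x ->
    y0 * rem a w ga de (x ^ 2) (y0 ^ 2) - c * eps ^ 5
    <= par a w 0 0 ga de x (eps * sqrt (W z))).
  { intros x z hx hz.
    assert (hz' : -1 < z < 1) by (destruct hz; lra).
    assert (z2 : z ^ 2 = x ^ 2) by (destruct hz; subst; ring).
    assert (hWz : 0 < W z) by (apply hW; lra).
    pose proof (Bd z ltac:(lra)) as [Bl Bu]. fold A in Bu.
    assert (Bu0 : W 0 <= A) by (apply Bd; lra).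
    pose proof (weight_lower w eps (W z) z hw ltac:(lra) s4 ltac:(lra) Bl) as wl.
    fold k1 in wl. rewrite z2 in wl.
    assert (wl0 : k1 * (x ^ 2 + eps ^ 2) <= eps ^ 2 * W 0 + w * x ^ 2).
    { apply (weight_lower w eps (W 0) x hw ltac:(lra) s4 ltac:(lra)).
      eapply Rle_trans; [|apply (proj1 (Bd 0 ltac:(lra)))].
      apply Rmult_le_compat_r; [left; apply Rinv_0_lt_compat; lra|].
      assert (0 <= x ^ 4) by (apply pow_le; lra). simpl in *; lra. }
    specialize (var x z hx hz).
    assert (q0 : 0 < sqrt (W z)) by now apply sqrt_lt_R0.
    assert (yy : (eps * sqrt (W z)) ^ 2 = eps ^ 2 * W z) by (rewrite Rpow_mult_distr, pow2_sqrt; lra).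
    unfold par. set (y := eps * sqrt (W z)) in *. rewrite yy, yy0.
    assert (X0 : 0 <= x ^ 2) by apply pow2_ge_0.
    set (X := x ^ 2) in *. set (U := eps ^ 2 * W z) in *. set (V := eps ^ 2 * W 0) in *.
    set (M := X + eps ^ 2) in *. assert (hM : 0 < M) by (unfold M; lra).
    assert (hkM : 0 < k1 * M) by now apply Rmult_lt_0_compat.
    assert (hU : 0 < U) by (apply Rmult_lt_0_compat; lra).
    assert (hV : 0 < V) by (apply Rmult_lt_0_compat; lra).
    assert (UA : U <= eps ^ 2 * A) by (apply Rmult_le_compat_l; lra).
    assert (VA : V <= eps ^ 2 * A) by (apply Rmult_le_compat_l; lra).
    pose proof (rem_abs_le a w ga de X U hw ha X0 ltac:(lra) ltac:(lra)) as b1.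
    pose proof (rem_lipschitz a w ga de X U V hw ha X0 ltac:(lra) ltac:(lra) ltac:(lra) ltac:(lra)) as b2.
    fold k in b1. fold Lg in b2.
    assert (b1' : k * U ^ 2 / (U + w * X) <= k * (eps ^ 2 * A) ^ 2 / (k1 * M)).
    { apply Rmult_le_compat.
      - mono.
      - left; apply Rinv_0_lt_compat; lra.
      - apply Rmult_le_compat_l; [lra|]. apply pow_incr; lra.
      - apply Rinv_le_contravar; lra. }
    assert (UV : Rabs (U - V) <= eps ^ 2 * (G * M)).
    { replace (U - V) with (eps ^ 2 * (W z - W 0)) by (unfold U, V; ring).
      rewrite Rabs_mult, (Rabs_right (eps ^ 2)) by lra. apply Rmult_le_compat_l; lra. }
    assert (b2' : Rabs (U - V) * ((U + V) / (U + w * X + (V + w * X)))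
                  <= eps ^ 2 * (G * M) * (eps ^ 2 * A / (k1 * M))).
    { apply Rmult_le_compat; [apply Rabs_pos | | exact UV |].
      - apply Rdiv_le_0_compat; lra.
      - replace (eps ^ 2 * A / (k1 * M)) with ((2 * (eps ^ 2 * A)) / (2 * (k1 * M))) by (field; lra).
        apply Rmult_le_compat; [lra | left; apply Rinv_0_lt_compat; lra | lra |].
        apply Rinv_le_contravar; lra. }
    apply (Rmult_le_compat_l Lg) in b2'; [|exact hLg].
    set (RU := rem a w ga de X U) in *. set (RV := rem a w ga de X V) in *.
    pose proof (sqrt_diff_le (W z) (W 0) lam ltac:(lra) ltac:(lra) hlam y0l) as sd.
    assert (dy : Rabs (y - y0) <= eps * (G * M / lam)).
    { replace (y - y0) with (eps * (sqrt (W z) - sqrt (W 0))) by (unfold y, y0; ring).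
      rewrite Rabs_mult, (Rabs_right eps) by lra. apply Rmult_le_compat_l; [lra|].
      eapply Rle_trans; [exact sd|]. apply Rmult_le_compat_r; [left; now apply Rinv_0_lt_compat | exact var]. }
    assert (T1 : Rabs ((y - y0) * RU) <= eps * (G * M / lam) * (k * (eps ^ 2 * A) ^ 2 / (k1 * M))).
    { rewrite Rabs_mult. apply Rmult_le_compat; try apply Rabs_pos; lra. }
    assert (T2 : Rabs (y0 * (RU - RV)) <= eps * sA * (Lg * (eps ^ 2 * (G * M) * (eps ^ 2 * A / (k1 * M))))).
    { rewrite Rabs_mult, (Rabs_right y0) by lra. apply Rmult_le_compat; try apply Rabs_pos; lra. }
    apply Rabs_le_between in T1. apply Rabs_le_between in T2.
    (* Here the factor [M = x^2 + eps^2] of the variation cancels the same factor in both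
       denominators, so the error no longer depends on [x]. *)
    replace (c * eps ^ 5) with
      (eps * (G * M / lam) * (k * (eps ^ 2 * A) ^ 2 / (k1 * M))
       + eps * sA * (Lg * (eps ^ 2 * (G * M) * (eps ^ 2 * A / (k1 * M))))).
    - replace (y * (0 * X + 0 * U + RU)) with (y0 * RV + (y - y0) * RU + y0 * (RU - RV)) by ring. lra.
    - unfold c. field. lra. }
  set (phi := fun x => 4 * y0 ^ 4 * K (x / y0) - 4 * c * eps ^ 5 * x).
  pose proof (half_turn_compare a w e1 p1 r1 0 0 ga de eps W phi
    (fun x => 4 * (y0 * rem a w ga de (x ^ 2) (y0 ^ 2)) - 4 * c * eps ^ 5)
    (eps ^ 4 * P) hw ha he hW) as KK.
  cbv beta in KK. fold L in KK.
  assert (D : forall x, is_derive phi x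
    (4 * (y0 * rem a w ga de (x ^ 2) (y0 ^ 2)) - 4 * c * eps ^ 5)).
  { intros x. unfold phi.
    apply (is_derive_minus (K := R_AbsRing) (V := R_NormedModule)
      (fun x => 4 * y0 ^ 4 * K (x / y0)) (fun x => 4 * c * eps ^ 5 * x)).
    2: { auto_derive; [exact Logic.I | ring]. }
    apply is_derive_eq with (4 * y0 ^ 4 *
      (/ y0 * ((ga * (x / y0) ^ 2 + de) / den a w ((x / y0) ^ 2) 1))).
    - apply is_derive_scal. apply (is_derive_comp K (fun x => x / y0)); [apply DK|].
      auto_derive; [exact Logic.I | field; lra].
    - pose proof (kernel_den_pos a w (x / y0) hw ha) as hd.
      assert (E : den a w (x ^ 2) (y0 ^ 2) = y0 ^ 4 * den a w ((x / y0) ^ 2) 1).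
      { unfold den. field. lra. }
      unfold rem. rewrite E. set (q := den a w ((x / y0) ^ 2) 1) in *. field. lra. }
  assert (M : phi 1 <= 2 * (eps ^ 2 * L) * (eps ^ 4 * P)).
  { apply KK.
    - assert (eps ^ 2 * L <= eps * L) by (apply Rmult_le_compat_r; lra). lra.
    - intros x. eapply is_derive_continuity_pt, D.
    - unfold phi. replace (0 / y0) with 0 by (field; lra). rewrite K0. ring.
    - intros x hx. unfold phi, Rminus. eapply Rle_trans; [apply Rabs_triang|].
      assert (y4p : 0 < y0 ^ 4) by now apply pow_lt.
      rewrite Rabs_Ropp, Rabs_mult, (Rabs_right (4 * y0 ^ 4)) by lra.
      assert (0 <= c * eps ^ 4) by mono.
      assert (0 <= 4 * c * eps ^ 5 * x) by mono.
      rewrite (Rabs_right (4 * c * eps ^ 5 * x)) by lra.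
      assert (4 * y0 ^ 4 * Rabs (K (x / y0)) <= 4 * (eps ^ 4 * A ^ 2) * B).
      { apply Rmult_le_compat; [lra | apply Rabs_pos | lra |]. apply hB.
        apply Rdiv_le_0_compat; lra. }
      assert (4 * c * eps ^ 5 * x <= 4 * (c * eps ^ 4) * 1).
      { replace (4 * c * eps ^ 5 * x) with (4 * (c * eps ^ 4) * (eps * x)) by (rewrite e5; ring).
        apply Rmult_le_compat_l; [lra | nra]. }
      unfold P. lra.
    - intros x _. apply D.
    - intros x hx. pose proof (pb x x hx (or_introl eq_refl)).
      pose proof (pb x (- x) hx (or_intror eq_refl)). lra. }
  unfold phi in M.
  assert (Kl : kp <= K (1 / y0)).
  { unfold Rdiv. rewrite Rmult_1_l. apply hK. lra. }
  assert (low : eps ^ 4 * l4 <= 4 * y0 ^ 4 * K (1 / y0)).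
  { unfold l4. replace (eps ^ 4 * (4 * lam ^ 4 * kp)) with (4 * (eps ^ 4 * lam ^ 4) * kp) by ring.
    apply Rmult_le_compat; [mono | lra | lra | exact Kl]. }
  assert (2 * (eps ^ 2 * L) * (eps ^ 4 * P) + 4 * c * eps ^ 5
          <= eps ^ 4 * (eps * (4 * c + 2 * L * P))).
  { rewrite e5.
    replace (2 * (eps ^ 2 * L) * (eps ^ 4 * P) + 4 * c * (eps * eps ^ 4))
      with (eps ^ 4 * (eps * (4 * c) + eps ^ 2 * (2 * L * P))) by ring.
    apply Rmult_le_compat_l; [lra|].
    assert (0 <= 2 * L * P) by mono.
    assert (eps ^ 2 * (2 * L * P) <= eps * (2 * L * P)) by (apply Rmult_le_compat_r; lra).
    lra. }
  assert (eps ^ 4 * (eps * (4 * c + 2 * L * P)) < eps ^ 4 * l4).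
  { apply Rmult_lt_compat_l; lra. }
  lra.
Qed.

(** * From periodic orbits to half turns *)

(** The division goes by ascending powers of [U], so that the remainder carries the factor [U^2],
    the source of its smallness where [U] is small against [X]. *)
Lemma division_by_den a w c0 c1 c2 c3 X U :
  w <> 0 -> den a w X U <> 0 ->
  let n := 2 * w - a ^ 2 in
  let q0 := c0 / w ^ 2 in
  let q1 := (c1 - q0 * n) / w ^ 2 in
  (c0 * X ^ 3 + c1 * X ^ 2 * U + c2 * X * U ^ 2 + c3 * U ^ 3) / den a w X U
  = q0 * X + q1 * U + rem a w (c2 - q0 - q1 * n) (c3 - q1) X U.
Proof.
  intros hw hd. cbv zeta. unfold rem. unfold den in *. field. split; assumption.
Qed.

Lemma quadratic_pos a w x y :
  0 < w -> a ^ 2 < 4 * w -> 0 < x ^ 2 + y ^ 2 -> 0 < y ^ 2 - a * x * y + w * x ^ 2.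
Proof.
  intros hw ha h.
  replace (y ^ 2 - a * x * y + w * x ^ 2)
    with ((y - a * x / 2) ^ 2 + (4 * w - a ^ 2) / 4 * x ^ 2) by field.
  pose proof (pow2_ge_0 (y - a * x / 2)).
  destruct (Req_dec x 0) as [-> | hx].
  - nra.
  - assert (0 < x ^ 2) by now apply pow2_gt_0.
    assert (0 < (4 * w - a ^ 2) / 4 * x ^ 2) by (apply Rmult_lt_0_compat; lra). lra.
Qed.

(** The coefficients [al], [be], [ga] of the even part of [- Q / q]. *)
Definition lead1 (w a b41 : R) : R := - (w * b41 + a) / w ^ 2.

Definition lead3 (w a b41 b32 b23 : R) : R :=
  (- (b41 + w * b23 + a * b32) - lead1 w a b41 * (2 * w - a ^ 2)) / w ^ 2.

Definition lead4 (w a b41 b32 b23 b14 b05 : R) : R :=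
  - (b23 + w * b05 + a * b14) - lead1 w a b41
  - lead3 w a b41 b32 b23 * (2 * w - a ^ 2).

(** Multiplying numerator and denominator by [q(- x, y)] makes the denominator even in [x]. The new
    numerator then splits by parity into [x] and [y] times binary cubics in [x^2], [y^2], and each
    cubic is divided separately. *)
Lemma slope_quotient w a b41 b32 b23 b14 b05 :
  0 < w -> a ^ 2 < 4 * w ->
  exists e1 p1 r1, forall x y, y <> 0 ->
    - Q35 b41 b32 b23 b14 b05 x y / (y ^ 2 - a * x * y + w * x ^ 2)
    = slope a w e1 p1 r1 (lead1 w a b41) (lead3 w a b41 b32 b23)
        (lead4 w a b41 b32 b23 b14 b05) (- b05 - lead3 w a b41 b32 b23) x y.
Proof.
  intros hw ha.
  set (n := 2 * w - a ^ 2).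
  set (q0 := w / w ^ 2). set (q1 := (1 + w * b32 + a * b41 - q0 * n) / w ^ 2).
  exists q1, (b32 + w * b14 + a * b23 - q0 - q1 * n), (b14 + a * b05 - q1).
  intros x y hy.
  assert (y2 : 0 < y ^ 2) by now apply pow2_gt_0.
  assert (x2 : 0 <= x ^ 2) by apply pow2_ge_0.
  pose proof (quadratic_pos a w x y hw ha ltac:(lra)) as h1.
  pose proof (quadratic_pos (- a) w x y hw ltac:(nra) ltac:(lra)) as h2.
  assert (hwx : 0 <= w * x ^ 2) by mono.
  assert (hd : 0 < den a w (x ^ 2) (y ^ 2)) by (apply den_pos; lra).
  pose proof (division_by_den a w w (1 + w * b32 + a * b41) (b32 + w * b14 + a * b23)
    (b14 + a * b05) (x ^ 2) (y ^ 2) ltac:(lra) ltac:(lra)) as E1.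
  pose proof (division_by_den a w (- (w * b41 + a)) (- (b41 + w * b23 + a * b32))
    (- (b23 + w * b05 + a * b14)) (- b05) (x ^ 2) (y ^ 2) ltac:(lra) ltac:(lra)) as E2.
  cbv zeta in E1, E2. fold n in E1, E2. fold q0 in E1. fold q1 in E1.
  change (- (w * b41 + a) / w ^ 2) with (lead1 w a b41) in E2.
  change ((- (b41 + w * b23 + a * b32) - lead1 w a b41 * n) / w ^ 2)
    with (lead3 w a b41 b32 b23) in E2.
  change (- (b23 + w * b05 + a * b14) - lead1 w a b41 - lead3 w a b41 b32 b23 * n)
    with (lead4 w a b41 b32 b23 b14 b05) in E2.
  unfold slope.
  replace (x ^ 2 / w) with (q0 * x ^ 2) by (unfold q0; field; lra).
  rewrite <- E1, <- E2.
  assert (F : den a w (x ^ 2) (y ^ 2)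
    = (y ^ 2 - a * x * y + w * x ^ 2) * (y ^ 2 - - a * x * y + w * x ^ 2)) by (unfold den; ring).
  rewrite F. unfold Q35. field. split; lra.
Qed.

(** The two vanishing conditions are solved for [b41] and [b23]; after substitution the claim is an
    identity in the free parameters. *)
Lemma L1_lead w a b41 b32 b23 b14 b05 :
  0 < w -> lead1 w a b41 = 0 -> lead3 w a b41 b32 b23 = 0 ->
  L1 (- w) a b41 b32 b23 b14 b05
  = - w ^ 4 * (lead4 w a b41 b32 b23 b14 b05 + w * (- b05 - lead3 w a b41 b32 b23)).
Proof.
  intros hw h1 h3. unfold lead4. rewrite h3. rewrite h1.
  unfold lead3 in h3. rewrite h1 in h3. unfold lead1 in h1.
  apply (f_equal (fun t => t * w ^ 2)) in h1, h3.
  assert (e1 : b41 = - a / w) by (field_simplify in h1; [field_simplify_eq|]; lra).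
  assert (e2 : b23 = (- b41 - a * b32) / w) by (field_simplify in h3; [field_simplify_eq|]; lra).
  rewrite e2, e1. unfold L1. field. lra.
Qed.

(** What the half turns take from a center: periodic orbits through the points of the axis [y = 0]
    near the origin, avoiding the origin so that their closest crossing is at positive distance.
    This form is stable under reversal. *)
Definition periodic_near (P Q : R -> R -> R) : Prop :=
  exists r, 0 < r /\ forall x0, 0 < Rabs x0 < r ->
    exists x y T, is_solution P Q x y /\ x 0 = x0 /\ y 0 = 0 /\
      periodic_with T x y /\ forall t, ~ (x t = 0 /\ y t = 0).

Lemma center_periodic_near P Q : center_at_origin P Q -> periodic_near P Q.
Proof.
  intros [_ [_ [r [hr H]]]]. exists r. split; [exact hr|]. intros x0 h0.
  destruct (H x0 0) as [x [y [hs [hx [hy [[T hT] [hn _]]]]]]].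
  - replace (x0 ^ 2 + 0 ^ 2) with (Rabs x0 ^ 2) by (rewrite pow2_abs; ring).
    split; [apply pow_lt; lra|]. nra.
  - exists x, y, T. repeat (split; [assumption|]). intros t [hx0 hy0].
    apply hn. exists t. now rewrite hx0, hy0.
Qed.

Lemma solution_continuous P Q x y :
  is_solution P Q x y -> continuity x /\ continuity y.
Proof.
  intros H. split; intros t; destruct (H t) as [h1 h2];
    eapply is_derive_continuity_pt; eassumption.
Qed.

(** The minimum over the closed set of zeros of [y] is found by minimizing [|y| + ||x| - inf|]. *)
Lemma minimal_crossing (x y : R -> R) T :
  continuity x -> continuity y -> periodic_with T x y -> y 0 = 0 ->
  exists s, 0 <= s <= T /\ y s = 0 /\
    forall t, 0 <= t <= 2 * T -> y t = 0 -> Rabs (x s) <= Rabs (x t).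
Proof.
  intros cx cy [hT hp] y0.
  (* The sign makes the supremum from [completeness] equal to minus the infimum of [|x|] over the
     crossings. *)
  set (E := fun v => exists t, 0 <= t <= T /\ y t = 0 /\ v = - Rabs (x t)).
  destruct (completeness E) as [m [ub lub]].
  { exists 0. intros v [t [_ [_ ->]]]. pose proof (Rabs_pos (x t)). lra. }
  { exists (- Rabs (x 0)). exists 0. repeat split; auto; lra. }
  set (D := fun t => Rabs (y t) + (Rabs (Rabs (x t) + m))).
  assert (cD : continuity D).
  { intros t. unfold D.
    assert (ca : forall f, continuity_pt f t -> continuity_pt (fun t => Rabs (f t)) t).
    { intros f hf. apply (continuity_pt_comp f Rabs); [exact hf | apply Rcontinuity_abs]. }
    apply continuity_pt_plus; apply ca; [apply cy|].
    apply continuity_pt_plus; [apply ca, cx|]. apply continuity_pt_const. now intros ? ?. }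
  destruct (continuity_ab_min D 0 T) as [s [hmin hs]]; [lra | intros; apply cD |].
  assert (D0 : D s <= 0).
  { apply Rnot_lt_le. intros hpos.
    assert (m <= m - D s); [|lra].
    apply lub. intros v [t [ht [yt ->]]].
    specialize (hmin t ht). unfold D at 2 in hmin. rewrite yt, Rabs_R0 in hmin.
    assert (- Rabs (x t) <= m) by (apply ub; exists t; auto).
    rewrite (Rabs_right (Rabs (x t) + m)) in hmin by lra. lra. }
  unfold D in D0. pose proof (Rabs_pos (y s)). pose proof (Rabs_pos (Rabs (x s) + m)).
  assert (ys : y s = 0) by (apply Rabs_eq_0; lra).
  assert (xs : Rabs (x s) + m = 0) by (apply Rabs_eq_0; lra).
  exists s. split; [exact hs|]. split; [exact ys|]. intros t ht yt.
  assert (G : forall t, 0 <= t <= T -> y t = 0 -> Rabs (x s) <= Rabs (x t)).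
  { intros u hu yu. assert (- Rabs (x u) <= m) by (apply ub; exists u; auto). lra. }
  (* The window extends to [2 T] because the orbit is later followed for a whole period starting at
     [s]. *)
  destruct (Rle_lt_dec t T) as [h | h]; [apply G; [lra | exact yt]|].
  destruct (hp (t - T)) as [px py]. replace (t - T + T) with t in px, py by ring.
  rewrite px. apply G; [lra|]. now rewrite <- py.
Qed.

(** While [y > 0], [x' = - y q] is negative, so the arc is a graph over the [x] axis; [y T = 0]
    makes it end. Minimality of [c] puts the end at or beyond [- c], so the graph covers [[- c, c]],
    with a possibly positive ordinate over [- c]. *)
Lemma half_turn_of_orbit w a b41 b32 b23 b14 b05 (x y : R -> R) c T (F : R -> R -> R) :
  0 < w -> a ^ 2 < 4 * w -> 0 < c -> 0 < T ->
  is_solution (P35 0 (- w) a) (Q35 b41 b32 b23 b14 b05) x y ->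
  x 0 = c -> y 0 = 0 -> y T = 0 ->
  (forall t, 0 < t <= T -> y t = 0 -> c <= Rabs (x t)) ->
  (forall u v, v <> 0 ->
     - Q35 b41 b32 b23 b14 b05 u v / (v ^ 2 - a * u * v + w * u ^ 2) = F u v) ->
  exists W, half_turn F c W.
Proof.
  intros hw ha hc hT hs x0 y0 yT hmin hF.
  destruct (solution_continuous _ _ _ _ hs) as [cx cy].
  set (P := P35 0 (- w) a) in *. set (Q := Q35 b41 b32 b23 b14 b05) in *.
  set (q := fun u v => v ^ 2 - a * u * v + w * u ^ 2) in *.
  assert (hPq : forall u v, P u v = - v * q u v) by (intros; unfold P, P35, q; ring).
  assert (start : exists t', 0 < t' < T /\ forall t, 0 < t <= t' -> 0 < y t).
  { destruct (hs 0) as [_ D]. rewrite x0, y0 in D.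
    assert (Qc : Q c 0 = c ^ 5) by (unfold Q, Q35; ring). rewrite Qc in D.
    assert (c5 : 0 < c ^ 5) by now apply pow_lt.
    (* The tolerance equals the derivative [c^5], which is just enough to keep [y t / t]
       positive. *)
    apply is_derive_Reals in D. destruct (D (c ^ 5) c5) as [d hd].
    pose proof (cond_pos d). exists (Rmin (d / 2) (T / 2)).
    pose proof (Rmin_l (d / 2) (T / 2)). pose proof (Rmin_r (d / 2) (T / 2)).
    assert (0 < Rmin (d / 2) (T / 2)) by (apply Rmin_pos; lra).
    split; [lra|]. intros t ht.
    specialize (hd t ltac:(lra)). rewrite Rabs_right in hd by lra.
    specialize (hd ltac:(lra)). rewrite Rplus_0_l, y0, Rminus_0_r in hd.
    apply Rabs_def2 in hd. assert (0 < y t / t) by lra.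
    replace (y t) with (y t / t * t) by (field; lra). apply Rmult_lt_0_compat; lra. }
  destruct start as [t' [ht' hpos']].
  destruct (first_zero y t' T) as [t1 [ht1 [yt1 hpos1]]];
    [lra | exact cy | apply hpos'; lra | lra |].
  assert (hpos : forall t, 0 < t < t1 -> 0 < y t).
  { intros t ht. destruct (Rle_lt_dec t t'); [apply hpos' | apply hpos1]; lra. }
  assert (qpos : forall u v, 0 < v -> 0 < q u v).
  { intros u v hv. apply quadratic_pos; auto.
    assert (0 < v ^ 2) by now apply pow_lt. pose proof (pow2_ge_0 u). lra. }
  assert (dec : forall s t, 0 <= s -> s < t -> t <= t1 -> x t < x s).
  { intros s t h1 h2 h3.
    destruct (mvt_open x (fun t => P (x t) (y t)) s t h2) as [u [hu E]].
    - intros u _. apply hs.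
    - intros u _. apply cx.
    - rewrite hPq in E. specialize (hpos u ltac:(lra)). specialize (qpos (x u) (y u) hpos).
      assert (0 < y u * q (x u) (y u)) by now apply Rmult_lt_0_compat. nra. }
  assert (xt1 : x t1 <= - c).
  { specialize (hmin t1 ltac:(lra) yt1). specialize (dec 0 t1 ltac:(lra) ltac:(lra) ltac:(lra)).
    unfold Rabs in hmin. destruct Rcase_abs; lra. }
  destruct (decreasing_inverse x 0 t1 ltac:(lra) cx dec) as [g [cg [gb gi]]].
  rewrite x0 in gi.
  assert (gin : forall z, - c < z < c -> 0 < g z < t1).
  { intros z hz. specialize (gb z). specialize (gi z ltac:(lra)). split.
    - destruct (proj1 gb) as [h | h]; [exact h|]. rewrite <- h, x0 in gi. lra.
    - destruct (proj2 gb) as [h | h]; [exact h|]. rewrite h in gi. lra. }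
  assert (c4 : 0 < c ^ 4) by now apply pow_lt.
  set (W := fun z => y (g (c * z)) ^ 2 / c ^ 4).
  assert (rng : forall z, -1 < z < 1 -> - c < c * z < c) by (intros; split; nra).
  exists W. split; [|split; [|split; [|split]]].
  - intros z. unfold W, Rdiv. apply continuity_pt_mult.
    2: { apply continuity_pt_const. now intros ? ?. }
    apply (continuity_pt_comp (fun z => y (g (c * z))) (fun v => v ^ 2)).
    + apply (continuity_pt_comp (fun z => g (c * z)) y); [|apply cy].
      apply (continuity_pt_comp (fun z => c * z) g); [|apply cg].
      apply is_derive_continuity_pt with c. auto_derive; [exact I | ring].
    + eapply is_derive_continuity_pt. auto_derive; [exact I | reflexivity].
  - unfold W. rewrite Rmult_1_r.
    assert (g c = 0).
    { specialize (gb c). specialize (gi c ltac:(lra)).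
      destruct (proj1 gb) as [h | h]; [|auto].
      specialize (dec 0 (g c) ltac:(lra) h ltac:(lra)). lra. }
    rewrite H, y0. field. lra.
  - unfold W. apply Rdiv_le_0_compat; [apply pow2_ge_0 | exact c4].
  - intros z hz. unfold W. apply Rdiv_lt_0_compat; [|exact c4].
    apply pow_lt, hpos, gin, rng, hz.
  - intros z hz. specialize (rng z hz). specialize (gin (c * z) rng).
    set (t := g (c * z)) in *. pose proof (hpos t gin) as yt.
    assert (xt : x t = c * z) by (apply gi; lra).
    pose proof (qpos (x t) (y t) yt) as qt.
    destruct (hs t) as [Dx Dy]. rewrite hPq in Dx.
    assert (Dg : is_derive g (c * z) (/ (- y t * q (x t) (y t)))).
    { apply is_derive_inverse with x; [apply cg | | exact Dx | nra].
      assert (hr : 0 < Rmin (c - c * z) (c * z + c)) by (apply Rmin_pos; lra).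
      exists (mkposreal _ hr). intros v hv. apply gi.
      unfold ball in hv; simpl in hv; unfold AbsRing_ball, abs, minus, plus, opp in hv; simpl in hv.
      apply Rabs_def2 in hv.
      pose proof (Rmin_l (c - c * z) (c * z + c)). pose proof (Rmin_r (c - c * z) (c * z + c)). lra. }
    set (Y := y t / c ^ 2).
    assert (c2 : 0 < c ^ 2) by now apply pow_lt.
    assert (hY : 0 < Y) by now apply Rdiv_lt_0_compat.
    assert (sW : sqrt (W z) = Y).
    { unfold W. fold t. replace (y t ^ 2 / c ^ 4) with (Y ^ 2) by (unfold Y; field; lra).
      apply sqrt_pow2; lra. }
    rewrite sW, <- hF by nra.
    assert (Dyg : is_derive (fun z => y (g (c * z))) z
                    (c * / (- y t * q (x t) (y t)) * Q (x t) (y t))).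
    { apply (is_derive_comp y (fun z => g (c * z))); [exact Dy|].
      apply (is_derive_comp g (fun z => c * z)); [exact Dg|].
      auto_derive; [exact I | ring]. }
    eapply is_derive_eq.
    + apply (is_derive_comp (fun v => v ^ 2 / c ^ 4) (fun z => y (g (c * z)))); [|exact Dyg].
      auto_derive; [exact I | reflexivity].
    + fold t. pose proof (qpos z (c * Y) ltac:(nra)) as q2.
      rewrite xt in *.
      (* The point is [c] times [(z, c * Y)], and [Q], [q] are homogeneous of degrees 5 and 2; the
         powers of [c] then cancel, leaving [c] only in the second argument of [F]. *)
      assert (E1 : Q (c * z) (y t) = c ^ 5 * Q z (c * Y)).
      { unfold Q, Q35, Y. field. lra. }
      assert (E2 : q (c * z) (y t) = c ^ 2 * q z (c * Y)).
      { unfold q, Y. field. lra. }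
      rewrite E1, E2. change ((c * Y) ^ 2 - a * z * (c * Y) + w * z ^ 2) with (q z (c * Y)).
      set (N := Q z (c * Y)). set (M := q z (c * Y)) in *.
      replace (y t) with (c ^ 2 * Y) by (unfold Y; field; lra).
      clearbody N M Y. unfold scal; simpl; unfold mult; simpl.
      field. repeat split; lra.
Qed.

(** * Symmetries of the family and the final sign argument *)

Lemma is_solution_shift P Q x y s :
  is_solution P Q x y -> is_solution P Q (fun t => x (s + t)) (fun t => y (s + t)).
Proof.
  intros H t. destruct (H (s + t)) as [hx hy].
  assert (D : is_derive (fun t => s + t) t 1) by (auto_derive; [exact I | ring]).
  split; (eapply is_derive_eq;
    [apply (is_derive_comp _ (fun t => s + t)); eassumption | apply Rmult_1_l]).
Qed.

Lemma is_solution_opp a21 a12 b41 b32 b23 b14 b05 x y :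
  is_solution (P35 0 a21 a12) (Q35 b41 b32 b23 b14 b05) x y ->
  is_solution (P35 0 a21 a12) (Q35 b41 b32 b23 b14 b05) (fun t => - x t) (fun t => - y t).
Proof.
  intros H t. destruct (H t) as [hx hy].
  split; (eapply is_derive_eq;
    [apply (is_derive_opp (K := R_AbsRing) (V := R_NormedModule)); eassumption|]);
    unfold opp; simpl; unfold P35, Q35; ring.
Qed.

Lemma is_solution_reverse a21 a12 b41 b32 b23 b14 b05 x y :
  is_solution (P35 0 a21 a12) (Q35 b41 b32 b23 b14 b05) x y ->
  is_solution (P35 0 a21 (- a12)) (Q35 (- b41) b32 (- b23) b14 (- b05))
    (fun t => - x (- t)) (fun t => y (- t)).
Proof.
  intros H t. destruct (H (- t)) as [hx hy].
  assert (D : is_derive (fun t => - t) t (- 1)) by (auto_derive; [exact I | ring]).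
  split; eapply is_derive_eq.
  - apply (is_derive_opp (K := R_AbsRing) (V := R_NormedModule) (fun t => x (- t))).
    apply (is_derive_comp x (fun t => - t)); eassumption.
  - unfold opp, scal; simpl; unfold mult; simpl; unfold P35; ring.
  - apply (is_derive_comp y (fun t => - t)); eassumption.
  - unfold scal; simpl; unfold mult; simpl; unfold Q35; ring.
Qed.

Lemma periodic_near_reverse a21 a12 b41 b32 b23 b14 b05 :
  periodic_near (P35 0 a21 a12) (Q35 b41 b32 b23 b14 b05) ->
  periodic_near (P35 0 a21 (- a12)) (Q35 (- b41) b32 (- b23) b14 (- b05)).
Proof.
  intros [r [hr H]]. exists r. split; [exact hr|]. intros x0 hx0.
  destruct (H (- x0)) as [x [y [T [hs [ex [ey [[hT hp] hn]]]]]]]; [now rewrite Rabs_Ropp|].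
  exists (fun t => - x (- t)), (fun t => y (- t)), T.
  split; [now apply is_solution_reverse|].
  rewrite Ropp_0, ex, ey. split; [ring|]. split; [reflexivity|]. split.
  - split; [exact hT|]. intros t. destruct (hp (- (t + T))) as [px py].
    replace (- (t + T) + T) with (- t) in px, py by ring. rewrite px, py. auto.
  - intros t [h1 h2]. apply (hn (- t)). split; [lra | exact h2].
Qed.

Lemma periodic_near_half_turn w a b41 b32 b23 b14 b05 (F : R -> R -> R) :
  0 < w -> a ^ 2 < 4 * w ->
  periodic_near (P35 0 (- w) a) (Q35 b41 b32 b23 b14 b05) ->
  (forall u v, v <> 0 ->
     - Q35 b41 b32 b23 b14 b05 u v / (v ^ 2 - a * u * v + w * u ^ 2) = F u v) ->
  ~ small (fun eps => forall W, ~ half_turn F eps W).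
Proof.
  intros hw ha [r [hr H]] hF [e0 [he0 hno]].
  pose proof (Rmin_l r e0). pose proof (Rmin_r r e0).
  assert (0 < Rmin r e0) by now apply Rmin_pos.
  set (x0 := Rmin r e0 / 2).
  assert (ax : Rabs x0 = x0) by (apply Rabs_right; unfold x0; lra).
  destruct (H x0) as [x [y [T [hs [ex [ey [[hT hp] hn]]]]]]]; [rewrite ax; unfold x0; lra|].
  destruct (solution_continuous _ _ _ _ hs) as [cx cy].
  destruct (minimal_crossing x y T cx cy (conj hT hp) ey) as [s [hsT [ys hmin]]].
  assert (hc : 0 < Rabs (x s)).
  { apply Rabs_pos_lt. intros E. now apply (hn s). }
  (* The starting point is itself a crossing, so the closest one is at most [x0] away from the
     origin. *)
  assert (hce : Rabs (x s) < e0).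
  { pose proof (hmin 0 ltac:(lra) ey) as h. rewrite ex, ax in h. unfold x0 in h. lra. }
  assert (yT : y (s + T) = 0) by (destruct (hp s) as [_ ->]; exact ys).
  assert (K : exists W, half_turn F (Rabs (x s)) W).
  { pose proof (is_solution_shift _ _ _ _ s hs) as hs'.
    destruct (Rcase_abs (x s)) as [neg | pos].
    - apply half_turn_of_orbit with w a b41 b32 b23 b14 b05
        (fun t => - x (s + t)) (fun t => - y (s + t)) T; auto.
      + now apply is_solution_opp.
      + rewrite Rplus_0_r, Rabs_left; auto.
      + rewrite Rplus_0_r; lra.
      + lra.
      + intros t ht yt. rewrite Rabs_Ropp. apply hmin; lra.
    - apply half_turn_of_orbit with w a b41 b32 b23 b14 b05
        (fun t => x (s + t)) (fun t => y (s + t)) T; auto.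
      + rewrite Rplus_0_r, Rabs_right; auto.
      + now rewrite Rplus_0_r.
      + intros t ht yt. apply hmin; [lra | exact yt]. }
  destruct K as [W hW]. exact (hno _ (conj hc hce) W hW).
Qed.

(** Lexicographic positivity; the indices 1, 3, 4 are the powers of [eps] at which the three numbers
    enter the comparison. *)
Definition leading_pos (w a b41 b32 b23 b14 b05 : R) : Prop :=
  let l1 := lead1 w a b41 in
  let l3 := lead3 w a b41 b32 b23 in
  let l4 := lead4 w a b41 b32 b23 b14 b05 + w * (- b05 - l3) in
  0 < l1 \/ (l1 = 0 /\ 0 < l3) \/ (l1 = 0 /\ l3 = 0 /\ 0 < l4).

Lemma leading_pos_not_periodic w a b41 b32 b23 b14 b05 :
  0 < w -> a ^ 2 < 4 * w -> leading_pos w a b41 b32 b23 b14 b05 ->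
  ~ periodic_near (P35 0 (- w) a) (Q35 b41 b32 b23 b14 b05).
Proof.
  intros hw ha hl hp.
  destruct (slope_quotient w a b41 b32 b23 b14 b05 hw ha) as [e1 [p1 [r1 hF]]].
  apply (periodic_near_half_turn w a b41 b32 b23 b14 b05 _ hw ha hp hF).
  destruct hl as [h1 | [[h1 h3] | [h1 [h3 h4]]]].
  - now apply no_half_turn_order1.
  - rewrite h1. now apply no_half_turn_order3.
  - revert h4. rewrite h1, h3. now apply no_half_turn_order4.
Qed.

Theorem proposition13
  (a30 a21 a12 b41 b32 b23 b14 b05 : R)
  (hLambda : Lambda a30 a21 a12)
  (hcenter : center_at_origin (P35 a30 a21 a12) (Q35 b41 b32 b23 b14 b05)) :
  L1 a21 a12 b41 b32 b23 b14 b05 = 0.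
Proof.
  destruct hLambda as [-> hd].
  set (w := - a21). assert (ea : a21 = - w) by (unfold w; ring). rewrite ea in *. clearbody w.
  pose proof (pow2_ge_0 a12).
  assert (hw : 0 < w) by lra. assert (ha : a12 ^ 2 < 4 * w) by lra.
  apply center_periodic_near in hcenter.
  assert (np : ~ leading_pos w a12 b41 b32 b23 b14 b05).
  { intros h. now apply (leading_pos_not_periodic w a12 b41 b32 b23 b14 b05). }
  assert (nn : ~ leading_pos w (- a12) (- b41) b32 (- b23) b14 (- b05)).
  { intros h. apply (leading_pos_not_periodic w (- a12) (- b41) b32 (- b23) b14 (- b05)); auto.
    - replace ((- a12) ^ 2) with (a12 ^ 2) by ring. exact ha.
    - now apply periodic_near_reverse. }
  unfold leading_pos in np, nn. cbv zeta in np, nn.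
  assert (f1 : lead1 w (- a12) (- b41) = - lead1 w a12 b41).
  { unfold lead1. field. lra. }
  assert (f3 : lead3 w (- a12) (- b41) b32 (- b23) = - lead3 w a12 b41 b32 b23).
  { unfold lead3. rewrite f1. field. lra. }
  assert (f4 : lead4 w (- a12) (- b41) b32 (- b23) b14 (- b05)
               = - lead4 w a12 b41 b32 b23 b14 b05).
  { unfold lead4. rewrite f1, f3. ring. }
  rewrite f4, f3, f1 in nn.
  (* The reversed system has the three opposite numbers, so a negative value contradicts [nn] and a
     positive one contradicts [np]. *)
  destruct (Rtotal_order (lead1 w a12 b41) 0) as [h1 | [h1 | h1]];
    [exfalso; apply nn; left; lra | | exfalso; apply np; left; lra].
  destruct (Rtotal_order (lead3 w a12 b41 b32 b23) 0) as [h3 | [h3 | h3]];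
    [exfalso; apply nn; right; left; split; lra | | exfalso; apply np; right; left; split; lra].
  rewrite (L1_lead w a12 b41 b32 b23 b14 b05 hw h1 h3).
  set (l4 := lead4 w a12 b41 b32 b23 b14 b05 + w * (- b05 - lead3 w a12 b41 b32 b23)) in *.
  destruct (Rtotal_order l4 0) as [h4 | [h4 | h4]].
  - exfalso. apply nn. right; right. repeat split; try lra. unfold l4 in h4. lra.
  - rewrite h4. ring.
  - exfalso. apply np. right; right. repeat split; lra.
Qed.
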